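(* For any integers $d\ge 1$, $c_1,\ldots,c_d\in\mathbb{N}\setminus\{2\}$ with $c_1\ge 3$, and any complex numbers $z_0,\ldots,z_d$ with $|z_j|<1$, $j=0,1,\ldots,d$, we have $$\sum_{a_0,a_1,\ldots,a_d\ge 0}\zeta^{\star}(\{2\}^{a_0},c_1,\{2\}^{a_1},\ldots,c_d,\{2\}^{a_d},1)\,z_0^{2a_0}z_1^{2a_1}\cdots z_d^{2a_d}=\sum_{k_0\ge k_1\ge\cdots\ge k_d\ge 1}\prod_{i=0}^d\frac{(-1)^{k_i\delta_i}k_i^{\delta_i-1}}{k_i^2-z_i^2}\,S^{\sharp}_{k_{i-1},k_i}(\{1\}^{c_i-3}),$$ where $c_0=c_{d+1}=1$, $k_{-1}=0$, $\delta_i=\delta(c_i)+\delta(c_{i+1})$ for $0\le i\le d$, and $\delta(c)=2$ if $c=0$, $\delta(c)=1$ if $c=1$, $\delta(c)=0$ if $c\ge 3$.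
   Context: $\mathbb{N}$ is the set of positive integers. For positive integers $s_1,\ldots,s_m$ with $s_1\ge 2$, $\zeta^\star(s_1,\ldots,s_m)=\sum_{k_1\ge\cdots\ge k_m\ge 1}\frac{1}{k_1^{s_1}\cdots k_m^{s_m}}$ (sum over positive integers), and $\zeta^\star(\emptyset)=1$. $\{s\}^a$ denotes the sequence consisting of $a$ copies of $s$. $\Delta(a,b)=0$ if $a=b$ and $\Delta(a,b)=1$ otherwise. For a string $\mathbf r=(r_1,\ldots,r_c)$ of positive integers and integers $k\ge 0$, $m\ge 1$, the multiple sharp sum is $$S^{\sharp}_{k,m}(r_1,\ldots,r_c)=\sum_{k\ge l_1\ge\cdots\ge l_c\ge m}\frac{2^{\Delta(k,l_1)+\Delta(l_1,l_2)+\cdots+\Delta(l_{c-1},l_c)+\Delta(l_c,m)}}{l_1^{r_1}\cdots l_c^{r_c}}\quad\text{if }\mathbf r\ne\emptyset\text{ and }k\ge m,$$ and $S^{\sharp}_{k,m}(\mathbf r)=2^{\Delta(k,m)}$ if $\mathbf r=\emptyset$ or $k<m$. The string $\{1\}^{c_i-3}$ is empty when $c_i\in\{1,3\}$, so that then $S^{\sharp}_{k_{i-1},k_i}(\{1\}^{c_i-3})=2^{\Delta(k_{i-1},k_i)}$. In all sums the indices are integers, and $0^0=1$ in power series. *)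

(* Defs.v *)
From HB Require Import structures.
From mathcomp Require Import all_boot all_order all_algebra.
From mathcomp Require Import all_classical all_reals all_analysis.
From mathcomp Require Import complex.

Set Implicit Arguments.
Unset Strict Implicit.
Unset Printing Implicit Defensive.

Import Order.TTheory GRing.Theory Num.Theory.

Local Open Scope classical_set_scope.
Local Open Scope ring_scope.
Local Open Scope complex_scope.

(* Unconditional summation: the partial sums over finite subsets of D converge
   to s along the inclusion order.  Over the complex numbers this is the same
   as absolute convergence with sum s. *)
Definition has_sum (K : numFieldType) (I : choiceType) (D : set I)
    (f : I -> K) (s : K) : Prop :=
  forall e : K, 0 < e -> exists2 A : set I, fsets D A &
    forall B : set I, fsets D B -> A `<=` B -> `|\sum_(i \in B) f i - s| < e.

(* k_1 >= ... >= k_n >= 1 *)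
Definition decreasing_chains (n : nat) : set (n.-tuple nat) :=
  [set k | sorted geq k && all (leq 1) k].
Arguments decreasing_chains n : clear implicits.

(* For the empty string there is exactly one chain, and the value is 1. *)
Definition zeta_star (R : realType) (s : seq nat) : R :=
  fine (\esum_(k in decreasing_chains (size s))
          (\prod_(j < size s) ((tnth k j)%:R ^+ nth 0%N s j)^-1)%:E).

Definition Delta (a b : nat) : nat := if a == b then 0%N else 1%N.

(* The pairs of consecutive entries of k, l_1, ..., l_c, m are those visited by
   pairmap; path geq says k >= l_1 >= ... >= l_c >= m. *)
Definition sharp_sum (K : numFieldType) (k m : nat) (r : seq nat) : K :=
  if (r == [::]) || (k < m)%N then 2 ^+ Delta k m
  else \sum_(l : (size r).-tuple 'I_k.+1 |
               path geq k (rcons (map val l) m))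
         2 ^+ sumn (pairmap Delta k (rcons (map val l) m)) /
         \prod_(j < size r) (tnth l j)%:R ^+ nth 0%N r j.

Definition delta (c : nat) : nat :=
  if c == 0%N then 2%N else if c == 1%N then 1%N else 0%N.

(* c_i for 0 <= i <= d + 1, where c_0 = c_(d+1) = 1 (the latter by default) *)
Definition entry (d : nat) (c : d.-tuple nat) (i : nat) : nat :=
  nth 1%N (1%N :: c) i.

Definition delta_at (d : nat) (c : d.-tuple nat) (i : nat) : nat :=
  (delta (entry c i) + delta (entry c i.+1))%N.

(* k_(i-1) for k = (k_0, ..., k_d), with k_(-1) = 0 *)
Definition prev_index (d : nat) (k : d.+1.-tuple nat) (i : nat) : nat :=
  nth 0%N (0%N :: k) i.

(* ({2}^a_0, c_1, {2}^a_1, ..., c_d, {2}^a_d, 1); the final 1 is c_(d+1) *)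
Definition two_string (d : nat) (c : d.-tuple nat) (a : d.+1.-tuple nat) :
    seq nat :=
  flatten [seq rcons (nseq (tnth a i) 2%N) (entry c i.+1) | i <- enum 'I_d.+1].

Definition generating_term (R : realType) (d : nat) (c : d.-tuple nat)
    (z : 'I_d.+1 -> R[i]) (a : d.+1.-tuple nat) : R[i] :=
  (zeta_star R (two_string c a))%:C *
  \prod_(i < d.+1) z i ^+ (2 * tnth a i).

(* The exponent delta_i - 1 may be -1.  The string {1}^(c_i - 3) uses truncated
   subtraction, so it is empty for c_i = 1 as well as for c_i = 3. *)
Definition sharp_term (R : realType) (d : nat) (c : d.-tuple nat)
    (z : 'I_d.+1 -> R[i]) (k : d.+1.-tuple nat) : R[i] :=
  \prod_(i < d.+1)
    ((-1) ^+ (tnth k i * delta_at c i) *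
     (tnth k i)%:R ^ ((delta_at c i)%:Z - 1) /
     ((tnth k i)%:R ^+ 2 - z i ^+ 2) *
     sharp_sum R[i] (prev_index k i) (tnth k i) (nseq (entry c i - 3) 1%N)).

(* Main.v *)
Require Import Defs.
From mathcomp Require Import all_boot all_order all_algebra.
From mathcomp Require Import all_classical all_reals all_analysis.
From mathcomp Require Import complex.
From mathcomp Require Import finmap ring zify.

(** Why the identity holds.

    Truncate: let S_n(s) be the zeta-star sum of s restricted to chains with
    largest index at most n, and let G_n be the generating function of the
    S_n({2}^a_0, c_1, ..., {2}^a_d, 1).  Put
    w_n(k) = n!^2 / ((n-k)! (n+k)!).  For every n there is an exact identity
    [genfunE]

      G_n = sum over n >= k_0 >= ... >= k_d >= 1 of
              w_n(k_0) * (sharp term of k_0, ..., k_d).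

    To find it, write a function of n as sum_k w_n(k) A(k) and follow the
    coefficients A while the string grows on the left.  Since
    n^2 w_(n-1)(k) = (n^2 - k^2) w_n(k), differencing in n multiplies A(k) by
    k^2 / n^2.  A block {2}^a summed against z^(2a) is the resolvent
    H(n) (1 - z^2/n^2) = H(n-1) + (new term), so it only divides A(k) by
    k^2 - z^2.  After multiplication by n^2, prepending an entry c brings in the
    factor n^(2-c); the functions n w_n(l) and w_n(l) / n are again combinations
    of the w_n(k) with k >= l, with coefficients 2^Delta(k,l) k and
    (-1)^(k+l) 2^Delta(k,l) / l, by telescoping in k ([binom_ratio_mul],
    [binom_ratio_div]).  An entry 1 uses the first expansion once; an entry
    c >= 3 iterates the second c - 2 times, and this iteration is the sharp sum
    of {1}^(c-3) ([sharp_sum_iter]).  The induction starts from the empty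
    string, 1 = w_n(0), whose coefficient sits at k = 0; this is where the
    factor 2 = 2^Delta(k_d,0) comes from.

    Now let n tend to infinity; w_n(k) increases to 1 and S_n increases to the
    zeta-star value.  Both sides pass to the limit by dominated convergence
    ([tannery]), so it remains to see that both families are absolutely
    summable.  On the sharp side each step costs at most a power of a logarithm,
    which is absorbed in the weight prod_(j <= k) (1 + 1/(2j)), of order
    sqrt k; the condition c_1 >= 3 leaves sqrt k_0 / k_0^2 for the outermost
    sum ([coefabs_bound], [coefabs_sum]).  On the zeta-star side all terms
    become nonnegative when z_j is replaced by |z_j|, and the finite identity
    at |z_j| bounds their sums by the bound just found ([zeta_term_usum]). *)

Set Implicit Arguments.
Unset Strict Implicit.
Unset Printing Implicit Defensive.

Import Order.TTheory GRing.Theory Num.Theory.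

Local Open Scope ring_scope.

(** * Unconditional sums and dominated convergence *)

Section USum.
Variables (K : numFieldType).

(** Finite sets of indices are duplicate-free sequences, so that preimages and
    unions stay elementary list operations; [usum_has_sum] returns to sets. *)
Definition usum (J : choiceType) (f : J -> K) (s : K) : Prop :=
  forall e : K, 0 < e -> exists A : seq J, forall B : seq J,
    uniq B -> {subset A <= B} -> `|\sum_(i <- B) f i - s| < e.

Definition tends (u : nat -> K) (l : K) : Prop :=
  forall e : K, 0 < e -> exists N, forall n, (N <= n)%N -> `|u n - l| < e.

Lemma small_eq (x : K) : (forall e : K, 0 < e -> `|x| < e) -> x = 0.
Proof.
move=> h; apply/eqP/negPn/negP => x0.
have x1 : 0 < `|x| by rewrite normr_gt0.
by have := h _ x1; rewrite ltxx.
Qed.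

Lemma tends_unique u a b : tends u a -> tends u b -> a = b.
Proof.
move=> ua ub; apply/eqP; rewrite -subr_eq0; apply/eqP/small_eq => e e0.
have e2 : 0 < e / 2 by rewrite divr_gt0.
have [N hN] := ua _ e2; have [N' hN'] := ub _ e2.
have := ltrD (hN (maxn N N') (leq_maxl _ _)) (hN' (maxn N N') (leq_maxr _ _)).
rewrite -splitr distrC; apply: le_lt_trans.
have -> : a - b = (a - u (maxn N N')) + (u (maxn N N') - b) by ring.
exact: ler_normD.
Qed.

Lemma tends0D u v : tends u 0 -> tends v 0 -> tends (fun n => u n + v n) 0.
Proof.
move=> hu hv e e0; have e2 : 0 < e / 2 by rewrite divr_gt0.
have [N hN] := hu _ e2; have [N' hN'] := hv _ e2.
exists (maxn N N') => n; rewrite geq_max => /andP[h1 h2].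
rewrite subr0 [e]splitr; apply: le_lt_trans (ler_normD _ _) _.
by apply: ltrD; [have := hN _ h1|have := hN' _ h2]; rewrite subr0.
Qed.

Lemma tends0Z a u : tends u 0 -> tends (fun n => u n * a) 0.
Proof.
move=> hu e e0; have a0 : 0 < `|a| + 1 by rewrite ltr_wpDl.
have [N hN] := hu (e / (`|a| + 1)) (divr_gt0 e0 a0).
exists N => n /hN; rewrite !subr0 normrM ltr_pdivlMr //; apply: le_lt_trans.
by rewrite ler_wpM2l // lerDl.
Qed.

Lemma tends0_sum (J : eqType) (B : seq J) (u : nat -> J -> K) :
  (forall i, i \in B -> tends (u^~ i) 0) ->
  tends (fun n => \sum_(i <- B) u n i) 0.
Proof.
elim: B => [_|i B IH h]; first by exists 0%N => n _; rewrite big_nil subrr normr0.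
have : tends (fun n => u n i + \sum_(j <- B) u n j) 0.
  apply: tends0D; first by apply: h; rewrite mem_head.
  by apply: IH => j jB; apply: h; rewrite in_cons jB orbT.
by move=> h' e /h' [N hN]; exists N => n /hN; rewrite big_cons.
Qed.

Section OneIndex.
Variable J : choiceType.
Implicit Types (f g : J -> K) (A B : seq J).

Lemma usum_eq f g s : f =1 g -> usum f s -> usum g s.
Proof. by move=> /funext ->. Qed.

Lemma usum_unique f s t : usum f s -> usum f t -> s = t.
Proof.
move=> fs ft; apply/eqP; rewrite -subr_eq0; apply/eqP/small_eq => e e0.
have e2 : 0 < e / 2 by rewrite divr_gt0.
have [A hA] := fs _ e2; have [A' hA'] := ft _ e2.
pose B := undup (A ++ A').
have sA : {subset A <= B} by move=> i; rewrite mem_undup mem_cat => ->.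
have sA' : {subset A' <= B}.
  by move=> i; rewrite mem_undup mem_cat => ->; rewrite orbT.
have := ltrD (hA B (undup_uniq _) sA) (hA' B (undup_uniq _) sA').
rewrite -splitr distrC; apply: le_lt_trans; set b := \sum_(i <- B) _.
have -> : s - t = (s - b) + (b - t) by ring.
exact: ler_normD.
Qed.

Lemma usum0 : usum (fun=> 0 : K) 0 (J := J).
Proof. by move=> e e0; exists [::] => B _ _; rewrite big1 // subrr normr0. Qed.

Lemma usumD f g s t : usum f s -> usum g t -> usum (fun i => f i + g i) (s + t).
Proof.
move=> fs gt e e0; have e2 : 0 < e / 2 by rewrite divr_gt0.
have [A hA] := fs _ e2; have [A' hA'] := gt _ e2.
exists (A ++ A') => B uB sB; rewrite [e]splitr big_split /=.
have sA : {subset A <= B} by move=> i iA; apply: sB; rewrite mem_cat iA.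
have sA' : {subset A' <= B} by move=> i iA; apply: sB; rewrite mem_cat iA orbT.
apply: le_lt_trans (ltrD (hA B uB sA) (hA' B uB sA')).
by rewrite opprD addrACA ler_normD.
Qed.

Lemma usumZ a f s : usum f s -> usum (fun i => a * f i) (a * s).
Proof.
move=> fs e e0; have a0 : 0 < `|a| + 1 by rewrite ltr_wpDl.
have [A hA] := fs _ (divr_gt0 e0 a0); exists A => B uB sB.
have := hA _ uB sB; rewrite ltr_pdivlMr // mulrC; apply: le_lt_trans.
by rewrite -mulr_sumr -mulrBr normrM ler_wpM2r // lerDl.
Qed.

Lemma usumB f g s t : usum f s -> usum g t -> usum (fun i => f i - g i) (s - t).
Proof.
move=> fs gt; rewrite -[- t]mulN1r; apply: usum_eq (usumD fs (usumZ (-1) gt)).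
by move=> i; rewrite mulN1r.
Qed.

Lemma usum_sum (r : seq nat) (f : nat -> J -> K) (s : nat -> K) :
  (forall l, usum (f l) (s l)) ->
  usum (fun i => \sum_(l <- r) f l i) (\sum_(l <- r) s l).
Proof.
move=> fs; elim: r => [|l r IH].
  by rewrite big_nil; apply: usum_eq usum0 => i; rewrite big_nil.
by rewrite big_cons; apply: usum_eq (usumD (fs l) IH) => i; rewrite big_cons.
Qed.

Lemma sub_bigD f A B : uniq A -> uniq B -> {subset A <= B} ->
  \sum_(i <- B) f i = \sum_(i <- A) f i + \sum_(i <- B | i \notin A) f i.
Proof.
move=> uA uB sAB; rewrite (bigID (mem A)) /=; congr (_ + _).
rewrite -big_filter; apply: perm_big; apply: uniq_perm => //.
  by rewrite filter_uniq.
by move=> i; rewrite mem_filter andb_idr //; exact: sAB.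
Qed.

(** The limit has to be assumed real: the order of a numeric field is partial. *)
Lemma usum_ge f s A : (forall i, 0 <= f i) -> s \is Num.real -> usum f s ->
  uniq A -> \sum_(i <- A) f i <= s.
Proof.
move=> f0 sr fs uA.
have Ar : \sum_(i <- A) f i \is Num.real by apply: ger0_real; apply: sumr_ge0.
rewrite real_leNgt //; apply/negP => lt.
have e0 : 0 < \sum_(i <- A) f i - s by rewrite subr_gt0.
have [A' hA'] := fs _ e0.
pose B := undup (A ++ A').
have sA : {subset A <= B} by move=> i; rewrite mem_undup mem_cat => ->.
have sA' : {subset A' <= B}.
  by move=> i; rewrite mem_undup mem_cat => ->; rewrite orbT.
have := hA' B (undup_uniq _) sA'; rewrite (sub_bigD f uA (undup_uniq _) sA).
set b := \sum_(i <- B | _) _; have b0 : 0 <= b by apply: sumr_ge0.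
rewrite ger0_norm ?subr_ge0; last by apply: ler_wpDr => //; exact: ltW.
by rewrite ltrD2r gtrDl => /(le_lt_trans b0); rewrite ltxx.
Qed.

(** Dominated convergence, in the form with limit 0: a finite set carrying all
    but a small part of the dominating sum controls the tail of every [f n] at
    once, and on that finite set pointwise convergence suffices. *)
Lemma tannery (f : nat -> J -> K) g (S : nat -> K) t :
  usum g t -> (forall n i, `|f n i| <= g i) ->
  (forall i, tends (f^~ i) 0) -> (forall n, usum (f n) (S n)) -> tends S 0.
Proof.
move=> gt fg f0 fS e e0; have e4 : 0 < e / 4 by rewrite divr_gt0.
have [A hA] := gt _ e4.
have [N hN] := @tends0_sum _ (undup A) f (fun i _ => f0 i) _ e4.
exists N => n nN; have [A' hA'] := fS n _ e4.
pose B := undup (undup A ++ A'); have uB : uniq B by apply: undup_uniq.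
have sA : {subset undup A <= B}.
  by move=> i iA; rewrite mem_undup mem_cat iA.
have sA' : {subset A' <= B}.
  by move=> i; rewrite mem_undup mem_cat => ->; rewrite orbT.
have h1 := hA' B uB sA'; have h2 := hN _ nN.
have h3 : `|\sum_(i <- B | i \notin undup A) f n i| < e / 4 + e / 4.
  have sAu : {subset A <= undup A} by move=> i; rewrite mem_undup.
  have := ltrD (hA B uB (fun i iA => sA i (sAu i iA)))
            (hA (undup A) (undup_uniq _) sAu).
  apply: le_lt_trans; rewrite [X in _ + X]distrC.
  apply: le_trans (ler_normD _ _); rewrite addrA subrK.
  rewrite (sub_bigD g (undup_uniq _) uB sA) addrAC subrr add0r.
  apply: le_trans (ler_norm_sum _ _ _) _.
  apply: le_trans (real_ler_norm _); first by apply: ler_sum.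
  by apply: ger0_real; apply: sumr_ge0 => i _; apply: le_trans (fg n i).
rewrite subr0; have -> : e = e / 4 + (e / 4 + (e / 4 + e / 4)) by field.
have := ltrD h1 (ltrD h2 h3); apply: le_lt_trans.
rewrite subr0 distrC -{1}[S n](subrK (\sum_(i <- B) f n i)).
apply: le_trans (ler_normD _ _) _; rewrite lerD2l.
by rewrite (sub_bigD (f n) (undup_uniq _) uB sA) ler_normD.
Qed.

End OneIndex.

Lemma big_pmap_oapp (I J : Type) (p : J -> option I) (f : I -> K) (B : seq J) :
  \sum_(i <- B) oapp f 0 (p i) = \sum_(i <- pmap p B) f i.
Proof.
elim: B => [|b B IH]; first by rewrite !big_nil.
by rewrite big_cons IH /=; case: (p b) => [x|] /=; rewrite ?big_cons ?add0r.
Qed.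

(** Extension by zero along an injection, given by its partial inverse; both
    the chains with prescribed first index and the exponent vectors with
    prescribed or decremented first exponent arise in this way. *)
Lemma usum_pinv (I J : choiceType) (h : I -> J) (p : J -> option I)
    (f : I -> K) s :
  pcancel h p -> ocancel p h -> usum f s -> usum (fun y => oapp f 0 (p y)) s.
Proof.
move=> hp ph fs e e0; have [A hA] := fs _ e0.
exists (map h A) => B uB sB.
rewrite big_pmap_oapp; apply: hA; first exact: (pmap_uniq ph).
move=> i iA; rewrite mem_pmap; apply/mapP; exists (h i); last by rewrite hp.
by apply: sB; rewrite map_f.
Qed.

Lemma usum_has_sum (I J : choiceType) (h : I -> J) (D : set I) (f : I -> K)
    (F : J -> K) s : injective h ->
  (forall i, D i -> f i = F (h i)) ->
  (forall y, (forall i, D i -> y <> h i) -> F y = 0) ->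
  usum F s -> has_sum D f s.
Proof.
move=> hi fF F0 Fs e e0; have [A hA] := Fs _ e0.
pose A' := (D `&` (h @^-1` [set` A]))%classic.
have fA' : finite_set A'.
  apply: (@sub_finite_set _ _ (h @^-1` [set` A])%classic); first by move=> i [].
  apply: (finite_preimage _ (finite_seq A)).
  by move=> x y _ _; exact: hi.
exists A'; first by split => // i [].
move=> B [fB BD] AB.
rewrite fsbig_finite //=.
set b := enum_fset (fset_set B).
have bB i : i \in b -> D i.
  by rewrite in_fset_set // => /set_mem /BD.
(* the members of A outside the image of h carry no mass *)
pose C := map h b ++ [seq y <- undup A | y \notin map h b].
have -> : \sum_(i <- b) f i = \sum_(y <- C) F y.
  rewrite big_cat /= big_map [X in _ + X]big_seq_cond [X in _ + X]big1 ?addr0.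
    by apply: eq_big_seq => i /bB /fF.
  move=> y; rewrite andbT mem_filter mem_undup => /andP[yb yA].
  apply: F0 => i Di yE; move/negP: yb; apply; rewrite yE map_f //.
  rewrite in_fset_set //; apply/mem_set; apply: AB; split => //=.
  by rewrite -yE.
apply: hA.
  rewrite cat_uniq map_inj_uniq // fset_uniq /= filter_uniq ?undup_uniq // andbT.
  by apply/hasPn => y; rewrite mem_filter => /andP[].
move=> y yA; rewrite mem_cat mem_filter mem_undup yA andbT.
by case: (y \in map h b).
Qed.

End USum.

Section ComplexSum.
Variables (R : realType) (J : choiceType).

Lemma usum_real (f : J -> R) (M : R) : (forall i, 0 <= f i) ->
  (forall B, uniq B -> \sum_(i <- B) f i <= M) -> exists s, usum f s.
Proof.
move=> f0 hM.
pose E : set R := [set x | exists2 B : seq J, uniq B & x = \sum_(i <- B) f i]%classic.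
have hE : has_sup E.
  split; first by exists 0, [::] => //; rewrite big_nil.
  by exists M => x [B uB ->]; exact: hM.
exists (sup E) => e e0; have [x [A uA ->] lt] := sup_adherent e0 hE.
exists A => B uB sB.
have h1 : \sum_(i <- B) f i <= sup E by apply: ub_le_sup; [case: hE|exists B].
have h2 : \sum_(i <- A) f i <= \sum_(i <- B) f i.
  by rewrite (sub_bigD f uA uB sB) lerDl sumr_ge0.
by rewrite distrC ger0_norm ?subr_ge0 // ltrBlDr -ltrBlDl (lt_le_trans lt).
Qed.

Lemma usum_realC (f : J -> R) s : usum f s -> usum (fun i => (f i)%:C%C) s%:C%C.
Proof.
move=> fs [a b]; rewrite ltcE /= => /andP[/eqP -> a0].
have [A hA] := fs _ a0; exists A => B uB sB.
rewrite -rmorph_sum -rmorphB normc_def /= expr0n addr0 sqrtr_sqr.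
by have := hA B uB sB; rewrite ltcR.
Qed.

(** Completeness, from suprema of reals: a real family dominated by v is the
    difference of the two nonnegative families f + v and v. *)
Lemma usum_exists (f : J -> R[i]) (M : R[i]) :
  (forall B, uniq B -> \sum_(i <- B) `|f i| <= M) -> exists s, usum f s.
Proof.
move=> hM; pose v i := complex.Re `|f i|.
have vE i : (v i)%:C%C = `|f i| by apply: RRe_real; apply: normr_real.
have hv B : uniq B -> \sum_(i <- B) v i <= complex.Re M.
  move=> /hM; rewrite lecE => /andP[_]; apply: le_trans.
  rewrite -lecR rmorph_sum RRe_real; last by apply: sum_real => i _; apply: normr_real.
  by apply: ler_sum => i _; rewrite -[X in _ <= X]vE.
have part (p : J -> R) : (forall i, `|p i| <= v i) -> exists s, usum p s.
  move=> pv; have v0 i : 0 <= v i by apply: le_trans (pv i).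
  have [t ht] := usum_real v0 hv.
  have [|B uB|w hw] := @usum_real (fun i => p i + v i) (complex.Re M + complex.Re M).
  - by move=> i; rewrite -lerBlDr sub0r; have := pv i; rewrite ler_norml => /andP[].
  - rewrite big_split lerD ?hv //; apply: le_trans (hv B uB).
    by apply: ler_sum => i _; apply: le_trans (pv i); apply: ler_norm.
  by exists (w - t); apply: usum_eq (usumB hw ht) => i; rewrite addrK.
have [|s hs] := part (fun i => complex.Re (f i)).
  by move=> i; rewrite -lecR vE normc_ge_Re.
have [|t ht] := part (fun i => complex.Im (f i)).
  by move=> i; rewrite -lecR vE normc_def lecR -sqrtr_sqr ler_wsqrtr // lerDr sqr_ge0.
exists (s%:C%C + 'i%C * t%:C%C).
apply: usum_eq (usumD (usum_realC hs) (usumZ _ (usum_realC ht))) => i.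
by rewrite -complexE.
Qed.
End ComplexSum.

(** * Sums over decreasing chains and truncated zeta-star values *)

Section PathSums.
Variable K : numFieldType.
Implicit Types (Ks : seq (nat -> nat -> K)) (e a b : nat -> K).

(** Kernels are lower triangular: [ker k l] is only read for l <= k. *)
Definition kernel_apply (ker : nat -> nat ->
  K) a k : K := \sum_(l < k.+1) ker k l * a l.

(** The iterated application of a list of kernels is the sum, over the chains
    below k, of the products of kernel values along the chain; [pathweight] is
    the summand of one chain, extended by zero to all sequences. *)
Definition pathsum Ks e : nat -> K := foldr kernel_apply e Ks.

Fixpoint pathweight Ks e (k : nat) (ls : seq nat) : K :=
  match Ks, ls with
  | [::], [::] => e k
  | ker :: Ks', l :: ls' =>
      if (l <= k)%N then ker k l * pathweight Ks' e l ls' else 0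
  | _, _ => 0
  end.

Definition uncons (l : nat) (s : seq nat) : option (seq nat) :=
  if s is l' :: s' then if l' == l then Some s' else None else None.

Lemma uncons_pcan l : pcancel (cons l) (uncons l).
Proof. by move=> s; rewrite /= eqxx. Qed.

Lemma uncons_ocan l : ocancel (uncons l) (cons l).
Proof. by case=> //= l' s; case: eqP => //= ->. Qed.

Lemma usum_pathweight Ks e k : usum (pathweight Ks e k) (pathsum Ks e k).
Proof.
elim: Ks k => [|ker Ks IH] k.
  move=> eps eps0; exists [:: [::]] => B uB sB.
  have nB : [::] \in B by apply: sB; rewrite mem_head.
  rewrite (bigD1_seq [::]) //= big1 ?addr0 ?subrr ?normr0 //.
  by case.
rewrite /= /kernel_apply -(big_mkord xpredT (fun l => ker k l * pathsum Ks e l)).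
apply: usum_eq (usum_sum _ (fun l =>
  usumZ (ker k l) (usum_pinv (@uncons_pcan l) (@uncons_ocan l) (IH l)))) => s.
rewrite big_mkord; case: s => [|l s] /=.
  by rewrite big1 // => l _; rewrite mulr0.
have z (i : 'I_k.+1) : l != i -> 
    ker k i * oapp (pathweight Ks e i) 0 (if l == i then Some s else None) = 0.
  by move=> /negbTE ->; rewrite mulr0.
case: leqP => lk; last first.
  by rewrite big1 // => i _; apply: z; rewrite gtn_eqF // (leq_trans _ lk).
rewrite (bigD1 (Ordinal (lk : (l < k.+1)%N))) //= eqxx big1 ?addr0 // => i il.
by apply: z; rewrite eq_sym.
Qed.

Lemma kernel_apply_ge0 ker a k : (forall l, (l <= k)%N -> 0 <= ker k l) ->
  (forall l, (l <= k)%N -> 0 <= a l) -> 0 <= kernel_apply ker a k.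
Proof.
by move=> h1 h2; apply: sumr_ge0 => l _; apply: mulr_ge0; [apply: h1|apply: h2];
  rewrite -ltnS.
Qed.

Lemma pathweightE Ks e k ls :
  pathweight Ks e k ls =
  if (size ls == size Ks) && path geq k ls then
    (\prod_(j < size Ks) nth (fun _ _ => 0) Ks j (nth 0%N (k :: ls) j) (nth 0%N ls j)) *
    e (last k ls) else 0.
Proof.
elim: Ks k ls => [|ker Ks IH] k [|l ls] //=; first by rewrite big_ord0 mul1r.
rewrite eqSS IH; case: (l <= k)%N; rewrite ?andbF //=.
case: ifP => _; last by rewrite mulr0.
by rewrite big_ord_recl /= mulrA.
Qed.

End PathSums.

Section Star.
Variable K : numFieldType.

(** Index 0 contributes nothing, as the inverse of 0 is 0, as soon as all
    entries of s are positive. *)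
Definition star (s : seq nat) (n : nat) : K :=
  pathsum [seq (fun _ m : nat => (m%:R ^+ p)^-1 : K) | p <- s] (fun=> 1) n.

Lemma starS p s n : star (p :: s) n.+1 = star (p :: s) n + (n.+1%:R ^+ p)^-1 *
  star s n.+1.
Proof. by rewrite /star /= /kernel_apply big_ord_recr. Qed.

Lemma star0 p s : (0 < p)%N -> star (p :: s) 0 = 0.
Proof.
by move=> p0; rewrite /star /= /kernel_apply big_ord1 expr0n (gtn_eqF p0) invr0 mul0r.
Qed.

Lemma star_ge0 s n : 0 <= star s n.
Proof.
elim: s n => [|p s IH] n; first by rewrite /star /= ler01.
by apply: sumr_ge0 => l _; apply: mulr_ge0 (IH _); rewrite invr_ge0 exprn_ge0.
Qed.

End Star.

(** The zeta-star value is defined over the reals, the generating function over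
    the complex numbers. *)
Lemma star_realC (R : realType) s n : star R[i] s n = (star R s n)%:C%C.
Proof.
elim: s n => [|p s IH] n //.
rewrite /star /= /kernel_apply rmorph_sum; apply: eq_bigr => m _ /=.
by rewrite rmorphM fmorphV rmorphXn rmorph_nat; congr (_ * _); apply: IH.
Qed.

Section ZetaStar.
Variables (R : realType) (s : seq nat).
Hypothesis s_gt0 : all (leq 1) s.

Let term (k : (size s).-tuple nat) : R :=
  \prod_(j < size s) ((tnth k j)%:R ^+ nth 0%N s j)^-1.

Let cut n (k : (size s).-tuple nat) : R :=
  pathweight [seq (fun _ m : nat => (m%:R ^+ p)^-1 : R) | p <- s] (fun=> 1) n k.

Lemma cutE n k : cut n k = if path geq n k then term k else 0.
Proof.
rewrite /cut pathweightE size_map size_tuple eqxx /=; case: ifP => // _.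
rewrite mulr1; apply: eq_bigr => j _.
by rewrite (nth_map 0%N) // (tnth_nth 0%N).
Qed.

Lemma term_ge0 k : 0 <= term k.
Proof. by apply: prodr_ge0 => j _; rewrite invr_ge0 exprn_ge0. Qed.

Lemma has_sum_cut n : has_sum (decreasing_chains (size s)) (cut n) (star R s n).
Proof.
apply: (@usum_has_sum _ _ _ val) (usum_pathweight _ _ _); first exact: val_inj.
  by [].
move=> y hy; rewrite pathweightE size_map.
case: eqP => //= ys; case: ifP => // py.
have [/hasP[x xy]|/hasPn h] := boolP (has (eq_op 0%N) y).
  move/eqP => x0; rewrite -{}x0 in xy.
  have iy : (index 0 y < size s)%N by rewrite -ys index_mem.
  rewrite (bigD1 (Ordinal iy)) //= (nth_map 0%N) // nth_index // expr0n.
  have -> : (nth 0%N s (index 0%N y) == 0)%N = false.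
    by apply/negbTE; rewrite -lt0n; apply: (allP s_gt0); rewrite mem_nth.
  by rewrite invr0 !mul0r.
have sy : size y == size s by apply/eqP.
case: (hy (Tuple sy)) => //; apply/andP; split => /=; first exact: path_sorted py.
by apply/allP => x /h; rewrite lt0n eq_sym.
Qed.

Lemma term_sum_le M (b : seq ((size s).-tuple nat)) :
  (forall n, star R s n <= M) -> uniq b ->
  (forall k, k \in b -> decreasing_chains (size s) k) ->
  \sum_(k <- b) term k <= M.
Proof.
move=> hM ub bD; (* a chain lies below n as soon as its first index does *)
pose n := \max_(k <- b) head 0%N k.
apply: le_trans (hM n).
have -> : \sum_(k <- b) term k = \sum_(k <- b) cut n k.
  apply: eq_big_seq => k kb; rewrite cutE.
  have hk : (head 0%N k <= n)%N by rewrite /n; apply: leq_bigmax_seq.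
  have /andP[/= sk _] := bD _ kb; case: (val k) sk hk => //= x t -> ->.
  by [].
rewrite -(big_map val xpredT (pathweight _ _ n)).
apply: usum_ge (usum_pathweight _ _ _) _;
  last by rewrite map_inj_uniq //; apply: val_inj.
  move=> ls; rewrite pathweightE; case: ifP => // _; rewrite mulr1.
  by rewrite size_map; apply: prodr_ge0 => j _; rewrite (nth_map 0%N).
exact: ger0_real (star_ge0 _ _ _).
Qed.

(** As a supremum over finite sets of chains, the zeta-star value is the
    supremum of its truncations: every finite set of chains lies below some n.
    The bound M is what makes the extended-real sum finite. *)
Lemma zeta_star_bound M : (forall n, star R s n <= M) ->
  (forall n, star R s n <= zeta_star R s) /\ zeta_star R s <= M.
Proof.
move=> hM; rewrite /zeta_star.
set E := (\esum_(k in _) _)%E.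
have hE : (E <= M%:E)%E.
  apply: ge_ereal_sup => _ [A [fA sA] <-].
  rewrite fsumEFin // lee_fin fsbig_finite //; apply: term_sum_le => //;
    first exact: fset_uniq.
  by move=> k; rewrite in_fset_set // => /set_mem /sA.
have E0 : (0 <= E)%E by apply: esum_ge0 => k _; rewrite lee_fin term_ge0.
have fE : (fine E)%:E = E.
  by rewrite fineK // ge0_fin_numE // (le_lt_trans hE) // ltry.
split; last by rewrite -lee_fin fE.
move=> n; apply/ler_addgt0Pr => e e0.
have [A [fA sA] hA] := has_sum_cut n e0.
have := hA A (conj fA sA) (@subset_refl _ A).
rewrite ltr_distlC => /andP[_ /ltW /le_trans]; apply.
rewrite lerD2r -lee_fin fE; apply: esum_ge; exists A => //.
rewrite fsumEFin // lee_fin !fsbig_finite //; apply: ler_sum => k _.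
by rewrite cutE; case: ifP => // _; exact: term_ge0.
Qed.

End ZetaStar.

(** * Sharp sums as iterated kernels *)

Section Sharp.
Variable K : numFieldType.

(** [sharp_sum] ranges over tuples in 'I_k.+1, a type that changes with k; the
  recursion needs one index type for all levels. *)
Let sharp_upto N m (r : seq nat) k : K :=
  \sum_(l : (size r).-tuple 'I_N | path geq k (rcons (map val l) m))
     2 ^+ sumn (pairmap Delta k (rcons (map val l) m)) /
     \prod_(j < size r) (tnth l j)%:R ^+ nth 0%N r j.

Lemma sharp_upto_nil N m k : sharp_upto N m [::] k =
  if (m <= k)%N then 2 ^+ Delta k m else 0.
Proof.
rewrite /sharp_upto big_mkcond (bigD1 [tuple]) //= [X in _ + X]big1 ?addr0.
  by rewrite andbT addn0 big1 ?divr1 // => -[].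
by move=> t /eqP[]; exact: tuple0.
Qed.

Lemma sharp_upto_cons N m p r k : sharp_upto N m (p :: r) k =
  \sum_(x < N | (x <= k)%N) 2 ^+ Delta k x / x%:R ^+ p * sharp_upto N m r x.
Proof.
rewrite /sharp_upto (reindex (fun xt : 'I_N * (size r).-tuple 'I_N =>
  cons_tuple xt.1 xt.2)) /=.
  rewrite -(pair_big_dep (fun x : 'I_N => (x <= k)%N)
    (fun x (t : (size r).-tuple 'I_N) => path geq x (rcons (map val t) m))
    (fun x t => 2 ^+ (Delta k x + sumn (pairmap Delta x (rcons (map val t) m))) /
     \prod_(j < (size r).+1) (tnth (cons_tuple x t) j)%:R ^+ nth 0%N (p :: r) j)) /=.
  apply: eq_bigr => x _; rewrite mulr_sumr; apply: eq_bigr => t _.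
  rewrite big_ord_recl /= exprD tnth0 invfM mulrACA; congr (_ * (_ / _)).
  by apply: eq_bigr => j _; rewrite tnthS.
exists (fun t => (thead t, behead_tuple t)).
  by move=> [x t] _ /=; congr pair; apply: val_inj.
by move=> t _; rewrite [RHS](tuple_eta t); apply: val_inj.
Qed.

Lemma sharp_upto_lt N m r k : (k < m)%N -> sharp_upto N m r k = 0.
Proof.
elim: r k => [|p r IH] k km; first by rewrite sharp_upto_nil leqNgt km.
rewrite sharp_upto_cons big1 // => x xk; rewrite IH ?mulr0 //.
exact: leq_ltn_trans xk km.
Qed.

Lemma sharp_upto_bound N N' m r k : (k < N)%N -> (k < N')%N ->
  sharp_upto N m r k = sharp_upto N' m r k.
Proof.
elim: r k => [|p r IH] k kN kN'; first by rewrite !sharp_upto_nil.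
rewrite !sharp_upto_cons.
have h M : (k < M)%N -> forall F : nat -> K,
    \sum_(x < M | (x <= k)%N) F x = \sum_(x < k.+1) F x.
  move=> kM F; rewrite (big_ord_widen M F) //.
rewrite (h _ kN (fun x => 2 ^+ Delta k x / x%:R ^+ p * sharp_upto N m r x)).
rewrite (h _ kN' (fun x => 2 ^+ Delta k x / x%:R ^+ p * sharp_upto N' m r x)).
apply: eq_bigr => x _; congr (_ * _); apply: IH.
  exact: leq_ltn_trans (leq_ord x) kN.
exact: leq_ltn_trans (leq_ord x) kN'.
Qed.

Lemma sharp_upto_sharp m r k : sharp_upto k.+1 m r k =
  if (m <= k)%N then sharp_sum K k m r else 0.
Proof.
case: leqP => mk; last exact: sharp_upto_lt.
rewrite /sharp_sum ltnNge mk orbF; case: eqP => // ->.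
by rewrite sharp_upto_nil mk.
Qed.

Definition sharp_kernel k l : K := 2 ^+ Delta k l / l%:R.

(** Peeling off the largest index l_1 of a sharp sum of ones applies the kernel
    once; the factor 1/m supplies the last application. *)
Lemma sharp_sum_iter p (b : nat -> K) k :
  \sum_(m < k.+1) sharp_sum K k m (nseq p 1%N) / m%:R * b m =
  iter p.+1 (kernel_apply sharp_kernel) b k.
Proof.
have E q j : \sum_(m < j.+1) sharp_upto j.+1 m (nseq q 1%N) j / m%:R * b m =
             iter q.+1 (kernel_apply sharp_kernel) b j.
  elim: q j => [|q IH] j.
    by apply: eq_bigr => m _; rewrite sharp_upto_nil leq_ord.
  transitivity (\sum_(x < j.+1) sharp_kernel j x * iter q.+1 (kernel_apply
    sharp_kernel) b x); last by [].
  under eq_bigr => m _ do rewrite sharp_upto_cons -!mulrA mulr_suml.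
  rewrite (exchange_big_dep xpredT) //=; apply: eq_bigr => x _.
  rewrite -[kernel_apply _ _ x]/(iter q.+1 (kernel_apply sharp_kernel) b x).
  rewrite -IH mulr_sumr.
  rewrite (big_ord_widen j.+1
    (fun m => sharp_kernel j x * (sharp_upto x.+1 m (nseq q 1%N) x / m%:R * b m))) //.
  rewrite leq_ord big_mkcond [RHS]big_mkcond; apply: eq_bigr => m _.
  rewrite expr1 -/(sharp_kernel j x) ltnS -mulrA; case: leqP => mx.
    by rewrite (@sharp_upto_bound j.+1 x.+1) // -mulrA.
  by rewrite sharp_upto_lt // mulr0 mul0r.
by rewrite -E; apply: eq_bigr => m _; rewrite sharp_upto_sharp leq_ord.
Qed.

Lemma sharp_sum_ge0 k m r : 0 <= sharp_sum K k m r.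
Proof.
rewrite /sharp_sum; case: ifP => _; first by rewrite exprn_ge0.
apply: sumr_ge0 => l _; apply: divr_ge0; first by rewrite exprn_ge0.
by apply: prodr_ge0 => j _; rewrite exprn_ge0.
Qed.

End Sharp.

(** * The binomial ratios n!^2 / ((n-k)! (n+k)!) *)

Section Binw.
Variable K : numFieldType.

(** n!^2 / ((n-k)! (n+k)!).  In this product form the truncated subtraction
    makes the value 0 for k > n. *)
Definition binom_ratio (n k : nat) : K := \prod_(j < k) ((n - j)%:R / (n + j).+1%:R).

Lemma binom_ratio0 n : binom_ratio n 0 = 1.
Proof. by rewrite /binom_ratio big_ord0. Qed.

Lemma binom_ratioSr n k : binom_ratio n k.+1 =
  binom_ratio n k * ((n - k)%:R / (n + k).+1%:R).
Proof. by rewrite /binom_ratio big_ord_recr. Qed.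

Lemma binom_ratio_gt n k : (n < k)%N -> binom_ratio n k = 0.
Proof.
by move=> nk; rewrite /binom_ratio (bigD1 (Ordinal nk)) //= subnn !mul0r.
Qed.

Lemma binom_ratio_ge0 n k : 0 <= binom_ratio n k.
Proof. by apply: prodr_ge0 => j _; rewrite divr_ge0. Qed.

Lemma binom_ratio_le1 n k : binom_ratio n k <= 1.
Proof.
apply: prodr_ile1 => j _; rewrite divr_ge0 //= ler_pdivrMr ?ltr0Sn // mul1r ler_nat.
by rewrite leqW // (leq_trans (leq_subr _ _)) // leq_addr.
Qed.

(** Differencing in n: w_n(k) - w_(n-1)(k) = w_n(k) k^2 / n^2. *)
Lemma binom_ratio_pred n k :
  n.+1%:R ^+ 2 * binom_ratio n k = (n.+1%:R ^+ 2 - k%:R ^+ 2) * binom_ratio n.+1 k.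
Proof.
elim: k => [|k IH]; first by rewrite !binom_ratio0 expr0n subr0.
have [kn|nk] := leqP k n; last first.
  have -> : binom_ratio n k.+1 = 0 by rewrite binom_ratio_gt // ltnW.
  have := nk; rewrite leq_eqVlt => /orP[/eqP <-|nk'];
    last by rewrite binom_ratio_gt ?mulr0 // ltnW.
  by rewrite binom_ratioSr subnn mul0r !mulr0.
rewrite !binom_ratioSr mulrA IH subSn // natrB // addSn.
have h1 : (n + k).+1%:R != 0 :> K by rewrite pnatr_eq0.
have h2 : (n + k).+2%:R != 0 :> K by rewrite pnatr_eq0.
have e1 : (n + k).+1%:R = n%:R + k%:R + 1 :> K by rewrite -addn1 !natrD.
have e2 : (n + k).+2%:R = n%:R + k%:R + 2 :> K by rewrite -addn2 !natrD.
have e3 : (n - k).+1%:R = n%:R - k%:R + 1 :> K by rewrite -addn1 natrD natrB.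
have e4 m : m.+1%:R = m%:R + 1 :> K by rewrite -addn1 natrD.
rewrite e1 e2 in h1 h2 *; rewrite e3 (e4 n) (e4 k).
by field; rewrite h1 h2.
Qed.

(** The factors of the product are at least 1 - (2j+1)/(n+1), and the sum of
    2j + 1 over j < k is k^2; this gives the convergence of w_n(k) to 1. *)
Lemma binom_ratio_compl n k : n.+1%:R * (1 - binom_ratio n k) <= k%:R ^+ 2.
Proof.
elim: k => [|k IH]; first by rewrite binom_ratio0 subrr mulr0 expr0n.
have e4 m : m.+1%:R = m%:R + 1 :> K by rewrite -addn1 natrD.
rewrite (e4 k) sqrrD expr1n mulr1 -addrA; apply: le_trans (lerD IH (lexx _)).
rewrite -lerBlDl -mulrBr [X in _ * X](_ : _ =
  binom_ratio n k - binom_ratio n k.+1); last by ring.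
rewrite binom_ratioSr.
have -> : binom_ratio n k - binom_ratio n k * ((n - k)%:R / (n + k).+1%:R) =
   binom_ratio n k * (1 - (n - k)%:R / (n + k).+1%:R) by rewrite mulrBr mulr1.
have nk0 : 0 < (n + k).+1%:R :> K by rewrite ltr0Sn.
have h : 1 - (n - k)%:R / (n + k).+1%:R <= (k%:R *+ 2 + 1) / (n + k).+1%:R :> K.
  rewrite lerBlDr -mulrDl ler_pdivlMr // mul1r.
  have -> : k%:R *+ 2 + 1 + (n - k)%:R = (k * 2 + 1 + (n - k))%:R :> K.
    by rewrite !natrD natrM mulr_natr.
  by rewrite ler_nat; lia.
have b0 := binom_ratio_ge0 n k; have b1 := binom_ratio_le1 n k.
apply: le_trans (ler_wpM2l (ler0n _ _) (ler_wpM2l b0 h)) _.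
set x := k%:R *+ 2 + 1; have x0 : 0 <= x by rewrite addr_ge0 // mulrn_wge0.
apply: (@le_trans _ _ (n.+1%:R * (x / (n + k).+1%:R))).
  by rewrite ler_wpM2l // ler_piMl // divr_ge0 // ltW.
by rewrite mulrCA ler_piMr // ler_pdivrMr // mul1r ler_nat ltnS leq_addr.
Qed.

Lemma triangle_exchange n (F : nat -> nat -> K) :
  \sum_(k < n.+1) \sum_(l < k.+1) F k l = \sum_(l < n.+1) \sum_(l <= k < n.+1) F k l.
Proof.
elim: n => [|n IH]; first by rewrite !big_ord1 big_nat1.
rewrite big_ord_recr IH [RHS](eq_bigr (fun l : 'I_n.+2 =>
  \sum_(l <= k < n.+1) F k l + F n.+1 l)); last first.
  by move=> l _; rewrite big_nat_recr // leq_ord.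
by rewrite big_split [X in _ = X + _]big_ord_recr /= [X in _ + X + _]big_geq // addr0.
Qed.

(** Expansion of n w_n(l).  The partial sums up to k = N telescope, with
    remainder (n - N) w_n(N), because (n - k) w_n(k) = (n + k + 1) w_n(k + 1). *)
Lemma binom_ratio_mul n l : (l <= n)%N ->
  \sum_(l <= k < n.+1) binom_ratio n k * (k%:R * 2 ^+ Delta k l) =
    n%:R * binom_ratio n l.
Proof.
move=> ln.
suff h m : (l + m <= n)%N ->
    \sum_(l <= k < (l + m).+1) binom_ratio n k * (k%:R * 2 ^+ Delta k l) =
    n%:R * binom_ratio n l - (n - (l + m))%:R * binom_ratio n (l + m).
  by have := h (n - l)%N; rewrite subnKC // subnn mul0r subr0; apply.
elim: m => [|m IH] lm.
  rewrite addn0 big_nat1 /Delta eqxx natrB //; ring.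
rewrite addnS in lm *.
rewrite big_nat_recr ?leqW ?leq_addr //= IH; last exact: ltnW.
rewrite /Delta gtn_eqF; last by rewrite ltnS leq_addr.
rewrite binom_ratioSr; set j := (l + m)%N.
have jn : (j < n)%N := lm.
have h1 : (n + j).+1%:R != 0 :> K by rewrite pnatr_eq0.
have e4 i : i.+1%:R = i%:R + 1 :> K by rewrite -addn1 natrD.
rewrite !natrB //; last exact: ltnW.
rewrite /= (e4 (n + j)%N) (e4 j) natrD in h1 *.
by field.
Qed.

(** Expansion of w_n(l) / n, by the same telescoping with alternating signs;
    as matrices in (k, l) the two expansions are inverse to each other. *)
Lemma binom_ratio_div n l : (l <= n)%N ->
  n%:R * \sum_(l <= k < n.+1) binom_ratio n k * ((-1) ^+ k * 2 ^+ Delta k l) =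
  (-1) ^+ l * (l%:R * binom_ratio n l).
Proof.
move=> ln.
suff h m : (l + m <= n)%N ->
    n%:R * (\sum_(l <= k < (l + m).+1) binom_ratio n k * ((-1) ^+ k * 2 ^+ Delta k l)) =
    (-1) ^+ l * (l%:R * binom_ratio n l) +
    (-1) ^+ (l + m) * ((n - (l + m))%:R * binom_ratio n (l + m)).
  by have := h (n - l)%N; rewrite subnKC // subnn mul0r mulr0 addr0; apply.
elim: m => [|m IH] lm.
  rewrite addn0 big_nat1 /Delta eqxx natrB //; ring.
rewrite addnS in lm *.
rewrite big_nat_recr ?leqW ?leq_addr //= mulrDr IH; last exact: ltnW.
rewrite /Delta gtn_eqF; last by rewrite ltnS leq_addr.
rewrite binom_ratioSr exprS; set j := (l + m)%N.
have jn : (j < n)%N := lm.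
have h1 : (n + j).+1%:R != 0 :> K by rewrite pnatr_eq0.
have e4 i : i.+1%:R = i%:R + 1 :> K by rewrite -addn1 natrD.
rewrite !natrB //; last exact: ltnW.
rewrite /= (e4 (n + j)%N) (e4 j) natrD in h1 *.
by field.
Qed.

End Binw.

Lemma tends_binom_ratio (R : realType) k : tends (fun n => binom_ratio R[i] n k - 1) 0.
Proof.
move=> [x y]; rewrite ltcE /= => /andP[/eqP -> x0].
exists (Num.bound (k%:R ^+ 2 / x)) => n nN.
have ks : k%:R ^+ 2 / x < n.+1%:R.
  apply: lt_le_trans (archi_boundP _) _; first by rewrite divr_ge0 ?exprn_ge0 // ltW.
  by rewrite ler_nat leqW.
rewrite subr0 distrC ger0_norm ?subr_ge0 ?binom_ratio_le1 //.
have n0 : 0 < n.+1%:R :> R[i] by rewrite ltr0Sn.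
rewrite -(ltr_pM2l n0); apply: le_lt_trans (binom_ratio_compl _ _ _) _.
have -> : n.+1%:R * (x +i* 0)%C = (n.+1%:R * x)%:C%C by rewrite rmorphM rmorph_nat.
have -> : k%:R ^+ 2 = (k%:R ^+ 2)%:C%C :> R[i] by rewrite rmorphXn rmorph_nat.
by rewrite ltcR -ltr_pdivrMr.
Qed.

(** * The finite identity *)

Section FiniteIdentity.
Variable K : numFieldType.

(** The solution of H(n) - H(n-1) = b(n) + (q / n^2) H(n), H(0) = 0: with
    q = z^2 and b(n) = B(n) / n^c it sums z^(2a) S_n({2}^a, c, ...) over a, where
    B(n) stands for the truncated sum of the string after c. *)
Fixpoint resolvent (q : K) (b : nat -> K) (n : nat) : K :=
  if n is m.+1 then (resolvent q b m + b n) / (1 - q / n%:R ^+ 2) else 0.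

(** The generating function of truncated zeta-star values, one pair (z_i, c_(i+1))
    per block {2}^a_i, c_(i+1). *)
Fixpoint genfun (L : seq (K * nat)) (n : nat) : K :=
  if L is p :: L' then
    resolvent (p.1 ^+ 2) (fun m => genfun L' m / m%:R ^+ p.2) n
  else 1.

(** The powers and signs that the entry c contributes to the index on its left
    and to the index on its right.  At an index k between c_i and c_(i+1) they
    multiply to (-1)^(k delta_i) k^(delta_i - 1); see [factor_split]. *)
Definition lfactor (c k : nat) : K := (-1) ^+ (k * (1 + delta c)) * k%:R ^+ delta c.
Definition rfactor (c l : nat) : K :=
  (-1) ^+ (l * (1 + delta c)) * l%:R ^ ((delta c)%:Z - 1).

Definition step_kernel (p : K * nat) (k l : nat) : K :=
  lfactor p.2 k / (k%:R ^+ 2 - p.1 ^+ 2) *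
  (rfactor p.2 l * sharp_sum K k l (nseq (p.2 - 3) 1%N)).

(** The coefficients of the generating function on the w_n(k); the initial
    coefficient is that of 1 = w_n(0). *)
Definition coef (L : seq (K * nat)) : nat -> K :=
  pathsum (map step_kernel L) (fun k => (k == 0%N)%:R).

Definition admissible (c : nat) := (c == 1%N) || (2 < c)%N.

Definition well_formed (L : seq (K * nat)) :=
  all (fun p : K * nat => (`|p.1| < 1) && admissible p.2) L && (last 1%N (map snd
    L) == 1%N).

Lemma well_formed_cons p L : well_formed (p :: L) ->
  [/\ `|p.1| < 1, admissible p.2, well_formed L & (L == [::]) ==> (p.2 == 1%N)].
Proof.
rewrite /well_formed /=; case: L => [|q L] /=.
  by rewrite andbT => /andP[/andP[-> ->] ->].
by move=> /andP[/andP[/andP[-> ->] ->] ->].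
Qed.

Lemma delta1 : delta 1 = 1%N. Proof. by []. Qed.
Lemma delta_gt2 c : (2 < c)%N -> delta c = 0%N. Proof. by case: c => [|[|[|c]]]. Qed.

Lemma step_kernel00 p : admissible p.2 -> step_kernel p 0 0 = 0.
Proof.
rewrite /step_kernel /lfactor /rfactor => /orP[/eqP ->|c2].
  by rewrite delta1 expr1 mulr0 !mul0r.
by rewrite delta_gt2 // sub0r exprN1 invr0 mulr0 mul0r mulr0.
Qed.

Lemma coef0 p L : admissible p.2 -> coef (p :: L) 0 = 0.
Proof. by move=> h; rewrite /coef /= /kernel_apply big_ord1 step_kernel00 // mul0r. Qed.

Lemma step_kernel_gt2 p k l : (2 < p.2)%N -> step_kernel p k l =
  (-1) ^+ k / (k%:R ^+ 2 - p.1 ^+ 2) *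
  ((-1) ^+ l / l%:R * sharp_sum K k l (nseq (p.2 - 3) 1%N)).
Proof.
move=> c2; rewrite /step_kernel /lfactor /rfactor delta_gt2 //.
by rewrite !addn0 !muln1 expr0 mulr1 sub0r exprN1.
Qed.

Lemma step_kernel_1 p k l : p.2 = 1%N ->
  step_kernel p k l = k%:R / (k%:R ^+ 2 - p.1 ^+ 2) * 2 ^+ Delta k l.
Proof.
move=> c1; rewrite /step_kernel /lfactor /rfactor c1 delta1 expr1 subrr expr0z.
by rewrite !muln2 -!mul2n !exprM sqrrN !expr1n !mul1r.
Qed.

Lemma step_kernel_apply p a k : (2 < p.2)%N ->
  kernel_apply (step_kernel p) a k = (-1) ^+ k / (k%:R ^+ 2 - p.1 ^+ 2) *
    iter (p.2 - 2) (kernel_apply (@sharp_kernel K)) (fun l => (-1) ^+ l * a l) k.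
Proof.
move=> c2; have -> : (p.2 - 2 = (p.2 - 3).+1)%N by lia.
rewrite -sharp_sum_iter mulr_sumr; apply: eq_bigr => l _.
by rewrite step_kernel_gt2 //; ring.
Qed.

Lemma step_kernel_apply1 p a k : p.2 = 1%N ->
  kernel_apply (step_kernel p) a k = k%:R / (k%:R ^+ 2 - p.1 ^+ 2) *
    \sum_(l < k.+1) 2 ^+ Delta k l * a l.
Proof.
by move=> c1; rewrite mulr_sumr; apply: eq_bigr => l _; rewrite step_kernel_1 // mulrA.
Qed.

(** Applying the kernel to alternating coefficients divides by n.  The condition
    b 0 = 0 is needed because the kernel kills the coefficient at 0. *)
Lemma binom_ratio_sharp_kernel n b : b 0%N = 0 ->
  n%:R * \sum_(k < n.+1) binom_ratio K n k * ((-1) ^+ k * kernel_apply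
    (@sharp_kernel K) b k) =
  \sum_(l < n.+1) binom_ratio K n l * ((-1) ^+ l * b l).
Proof.
move=> b0.
under eq_bigr => k _ do rewrite mulrA mulr_sumr.
rewrite (triangle_exchange n (fun k l => binom_ratio K n k * (-1) ^+ k *
  (sharp_kernel K k l * b l))).
rewrite mulr_sumr; apply: eq_bigr => l _.
have -> : \sum_(l <= k < n.+1) binom_ratio K n k * (-1) ^+ k * (sharp_kernel K k
  l * b l) =
  (\sum_(l <= k < n.+1) binom_ratio K n k * ((-1) ^+ k * 2 ^+ Delta k l)) * (b l
    / l%:R).
  by rewrite mulr_suml; apply: eq_bigr => k _; rewrite /sharp_kernel; ring.
rewrite mulrA binom_ratio_div ?leq_ord //.
case: (nat_of_ord l) => [|m]; first by rewrite b0 !(mul0r, mulr0).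
have h : m.+1%:R != 0 :> K by rewrite pnatr_eq0.
by field.
Qed.

Lemma sharp_kernel0 b : kernel_apply (@sharp_kernel K) b 0 = 0.
Proof. by rewrite /kernel_apply big_ord1 /sharp_kernel invr0 mulr0 mul0r. Qed.

Lemma binom_ratio_iter_sharp_kernel n p b : b 0%N = 0 ->
  n%:R ^+ p * \sum_(k < n.+1) binom_ratio K n k * ((-1) ^+ k * iter p
    (kernel_apply (@sharp_kernel K)) b k) =
  \sum_(l < n.+1) binom_ratio K n l * ((-1) ^+ l * b l).
Proof.
move=> b0; elim: p => [|p IH]; first by rewrite mul1r.
rewrite exprSr -mulrA -IH; congr (_ * _); apply: binom_ratio_sharp_kernel.
by case: p {IH} => //= p; rewrite sharp_kernel0.
Qed.

Lemma sqr_sub_neq0 (z : K) (k : nat) : `|z| < 1 -> (0 < k)%N -> k%:R ^+ 2 - z ^+ 2 != 0.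
Proof.
move=> z1 k0; rewrite subr_eq0; apply/eqP => /(congr1 Num.norm) /eqP.
rewrite !normrX normr_nat eqrXn2 //.
by rewrite gt_eqF // (lt_le_trans z1) // ler1n.
Qed.

(** The finite identity.  After multiplying the resolvent equation by n^2 and
    using [binom_ratio_pred], the coefficient at k gains the factor k^2 - z^2,
    which cancels the denominator of the kernel; what is left is the expansion of
    multiplication by n^(2-c). *)
Lemma genfunE L n : well_formed L ->
  genfun L n = \sum_(k < n.+1) binom_ratio K n k * coef L k.
Proof.
elim: L n => [|p L IH] n wf.
  rewrite big_ord_recl big1 => [|k _]; first by rewrite binom_ratio0 mulr1 addr0.
  by rewrite /coef /= mulr0.
have [z1 adm wfL lastp] := well_formed_cons wf.
pose c k := coef (p :: L) k; rewrite -/c.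
elim: n => [|n IHn]; first by rewrite big_ord1 /c coef0 // mulr0.
have N0 : n.+1%:R != 0 :> K by rewrite pnatr_eq0.
have Nz := sqr_sub_neq0 z1 (ltn0Sn n).
rewrite [LHS]/= -/(genfun (p :: L) n) IHn IH //.
have step : \sum_(k < n.+2) binom_ratio K n.+1 k * ((k%:R ^+ 2 - p.1 ^+ 2) * c k) =
    n.+1%:R ^+ 2 / n.+1%:R ^+ p.2 * \sum_(k < n.+2) binom_ratio K n.+1 k * coef L k.
  (* at k = 0 the coefficient vanishes, which replaces k^2 != z^2 *)
  have cE k (g : K) : (k = 0%N -> g = 0) -> c k = g / (k%:R ^+ 2 - p.1 ^+ 2) ->
      (k%:R ^+ 2 - p.1 ^+ 2) * c k = g.
    move=> g0; case: k g0 => [->|k _ ->] //; first by rewrite /c coef0 // mulr0.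
    by rewrite mulrC divfK // sqr_sub_neq0.
  case/orP: adm => [/eqP p1|p2].
    have dE k : (k%:R ^+ 2 - p.1 ^+ 2) * c k =
        k%:R * \sum_(l < k.+1) 2 ^+ Delta k l * coef L l.
      apply: cE => [->|]; first by rewrite mul0r.
      by rewrite /c {1}/coef /= step_kernel_apply1 // mulrAC.
    under eq_bigr => k _ do rewrite dE mulrA mulr_sumr.
    rewrite (triangle_exchange n.+1 (fun k l =>
      binom_ratio K n.+1 k * k%:R * (2 ^+ Delta k l * coef L l))).
    rewrite p1 expr1 expr2 mulfK // mulr_sumr; apply: eq_bigr => l _.
    rewrite mulrA -binom_ratio_mul ?leq_ord // mulr_suml.
    by apply: eq_bigr => k _; rewrite !mulrA.
  have cL0 : coef L 0 = 0.
    case: L wfL lastp {IH wf c cE IHn} => [|q L] wfL;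
      first by rewrite eqxx /= => /eqP h; rewrite h in p2.
    by have [_ admq _ _] := well_formed_cons wfL; rewrite coef0.
  have dE k : (k%:R ^+ 2 - p.1 ^+ 2) * c k =
      (-1) ^+ k * iter (p.2 - 2) (kernel_apply (@sharp_kernel K)) (fun l =>
        (-1) ^+ l * coef L l) k.
    apply: cE => [->|]; last by rewrite /c {1}/coef /= step_kernel_apply // mulrAC.
    have -> : (p.2 - 2 = (p.2 - 3).+1)%N by lia.
    by rewrite iterS sharp_kernel0 mulr0.
  under eq_bigr => k _ do rewrite dE.
  have -> : n.+1%:R ^+ p.2 = n.+1%:R ^+ 2 * n.+1%:R ^+ (p.2 - 2) :> K.
    by rewrite -exprD subnKC // ltnW.
  rewrite invfM mulrA divff ?expf_neq0 // mul1r.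
  apply: (mulfI (expf_neq0 (p.2 - 2) N0)).
  rewrite binom_ratio_iter_sharp_kernel ?cL0 ?mulr0 // mulrA divff ?expf_neq0 // mul1r.
  by apply: eq_bigr => l _; rewrite mulrA -exprMn mulrNN mulr1 expr1n mul1r.
have prev : n.+1%:R ^+ 2 * \sum_(k < n.+1) binom_ratio K n k * c k =
    \sum_(k < n.+2) (n.+1%:R ^+ 2 - k%:R ^+ 2) * binom_ratio K n.+1 k * c k.
  rewrite [RHS]big_ord_recr /= subrr !mul0r addr0 mulr_sumr.
  by apply: eq_bigr => k _; rewrite mulrA binom_ratio_pred.
have d0 : 1 - p.1 ^+ 2 / n.+1%:R ^+ 2 != 0.
  have -> : 1 - p.1 ^+ 2 / n.+1%:R ^+ 2 = (n.+1%:R ^+ 2 - p.1 ^+ 2) / n.+1%:R ^+ 2.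
    by rewrite mulrBl divff // expf_neq0.
  by rewrite mulf_neq0 // invr_eq0 expf_neq0.
apply: (mulIf d0); rewrite divfK //; apply: (mulfI (expf_neq0 2 N0)).
rewrite mulrDr prev [X in _ + X]mulrCA [X in _ + X]mulrC -step -big_split /=.
rewrite mulrCA mulrBr mulr1 [X in _ - X]mulrC divfK ?expf_neq0 // mulr_suml.
by apply: eq_bigr => k _; rewrite -/(c k); ring.
Qed.


End FiniteIdentity.

(** * Absolute convergence of the sharp side *)

Section Bounds.
Variable K : numFieldType.

(** A weight of order sqrt k.  Any exponent strictly between 0 and 1 would do:
    positive so that summation against 1/l preserves the weight up to a
    constant, less than 1 so that its sum against 1/k^2 converges. *)
Definition growth (k : nat) : K := \prod_(j < k) (1 + (2 * j.+1%:R)^-1).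

Lemma growthS k : growth k.+1 = growth k * (1 + (2 * k.+1%:R)^-1).
Proof. by rewrite /growth big_ord_recr. Qed.

Lemma growth_ge0 k : 0 <= growth k.
Proof. by apply: prodr_ge0 => j _; rewrite addr_ge0 // invr_ge0 mulr_ge0. Qed.

Lemma growth_ge1 k : 1 <= growth k.
Proof.
elim: k => [|k IH]; first by rewrite /growth big_ord0.
by apply: le_trans IH _; rewrite growthS ler_peMr ?growth_ge0 // lerDl invr_ge0
  mulr_ge0.
Qed.

Lemma growth_sum k : \sum_(l < k.+1) growth l / l%:R <= 3 * growth k.
Proof.
elim: k => [|k IH]; first by rewrite big_ord1 invr0 mulr0 mulr_ge0 ?growth_ge0.
rewrite big_ord_recr /=; apply: le_trans (lerD IH (lexx _)) _.
rewrite -subr_ge0 growthS.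
have h : k%:R + 1 != 0 :> K by rewrite natr1 pnatr_eq0.
have -> : 3 * (growth k * (1 + (2 * k.+1%:R)^-1)) -
   (3 * growth k + growth k * (1 + (2 * k.+1%:R)^-1) / k.+1%:R) =
   growth k * (k%:R / (2 * k.+1%:R ^+ 2)) by rewrite -natr1; field.
by rewrite mulr_ge0 ?growth_ge0 // divr_ge0 // mulr_ge0 // exprn_ge0.
Qed.

(** The partial sums up to n >= 1 are at most 6 - 3 growth(n)/n, by induction. *)
Lemma growth_sum2 n : \sum_(k < n.+1) growth k / k%:R ^+ 2 <= 6.
Proof.
case: n => [|n]; first by rewrite big_ord1 expr0n invr0 mulr0.
apply: (@le_trans _ _ (6 - 3 * (growth n.+1 / n.+1%:R))); last first.
  by rewrite gerBl mulr_ge0 // divr_ge0 // growth_ge0.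
elim: n => [|n IH].
  rewrite big_ord_recr big_ord1 /= expr0n invr0 mulr0 add0r growthS /growth big_ord0.
  by rewrite -subr_ge0 (_ : _ - _ = 0) //; field.
rewrite big_ord_recr /=; apply: le_trans (lerD IH (lexx _)) _.
rewrite -subr_ge0 (growthS n.+1).
set m := n.+1.
have -> : 6 - 3 * (growth m * (1 + (2 * m.+1%:R)^-1) / m.+1%:R) -
   (6 - 3 * (growth m / m%:R) + growth m * (1 + (2 * m.+1%:R)^-1) / m.+1%:R ^+ 2) =
   growth m * ((m%:R ^+ 2 + 6 * m%:R + 6) / (2 * m%:R * m.+1%:R ^+ 3)).
  rewrite -natr1 /m -natr1; field.
  by rewrite -(natrD K 2 n) -(natrD K 1 n) !pnatr_eq0.
by rewrite mulr_ge0 ?growth_ge0 // divr_ge0 // ?addr_ge0 ?mulr_ge0 ?exprn_ge0.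
Qed.

Definition bounded_by (M : K) (b : nat -> K) := forall k, 0 <= b k <= M * growth k.

Lemma sharp_kernel_bound M b : 0 <= M -> bounded_by M b ->
  bounded_by (6 * M) (kernel_apply (@sharp_kernel K) b).
Proof.
move=> M0 hb k; apply/andP; split.
  apply: kernel_apply_ge0 => l _; first by rewrite divr_ge0 // exprn_ge0.
  by case/andP: (hb l).
rewrite (_ : 6 * M * growth k = 2 * M * (3 * growth k)); last by ring.
apply: le_trans (ler_wpM2l _ (growth_sum k)); last by rewrite mulr_ge0.
rewrite mulr_sumr; apply: ler_sum => l _; case/andP: (hb l) => b0 bM.
rewrite /sharp_kernel.
have D2 : 2 ^+ Delta k l <= 2 :> K.
  by rewrite /Delta; case: ifP => _; rewrite ?expr1 ?expr0 ?ler1n.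
have -> : 2 ^+ Delta k l / l%:R * b l = (2 ^+ Delta k l * b l) / l%:R by rewrite mulrAC.
have -> : 2 * M * (growth l / l%:R) = 2 * (M * growth l) / l%:R by rewrite !mulrA.
by rewrite ler_wpM2r ?invr_ge0 // ler_pM ?exprn_ge0.
Qed.

Lemma iter_sharp_kernel_bound p M b : 0 <= M -> bounded_by M b ->
  bounded_by (6 ^+ p * M) (iter p (kernel_apply (@sharp_kernel K)) b).
Proof.
move=> M0 hb; elim: p => [|p IH]; first by rewrite mul1r.
by rewrite exprS -mulrA; apply: sharp_kernel_bound => //; rewrite mulr_ge0 // exprn_ge0.
Qed.

(** The coefficients with every kernel replaced by its absolute value: the sums
    of the absolute values of the chain terms. *)
Definition coefabs (L : seq (K * nat)) : nat -> K :=
  pathsum [seq (fun k l => `|step_kernel p k l|) | p <- L] (fun k => (k == 0%N)%:R).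

Lemma coefabs_ge0 L k : 0 <= coefabs L k.
Proof. by elim: L k => [|p L IH] k; first exact: ler0n; apply: kernel_apply_ge0
  => l _; [exact: normr_ge0|exact: IH]. Qed.

Lemma coef_le L k : `|coef L k| <= coefabs L k.
Proof.
elim: L k => [|p L IH] k; first by rewrite /coef /coefabs /= normr_nat.
apply: le_trans (ler_norm_sum _ _ _) _; apply: ler_sum => l _.
by rewrite normrM; apply: ler_wpM2l; [exact: normr_ge0|exact: IH].
Qed.

Lemma coefabs0 p L : admissible p.2 -> coefabs (p :: L) 0 = 0.
Proof. by move=> h; rewrite /coefabs /= /kernel_apply big_ord1 step_kernel00 //
  normr0 mul0r. Qed.

Lemma denom_le (z : K) k : `|z| < 1 -> (0 < k)%N ->
  `|(k%:R ^+ 2 - z ^+ 2)^-1| <= (1 - `|z| ^+ 2)^-1 / k%:R ^+ 2.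
Proof.
move=> z1 k0; have kp : 0 < k%:R :> K by rewrite ltr0n.
have d0 : 0 < 1 - `|z| ^+ 2 by rewrite subr_gt0 expr_lt1.
rewrite -invfM normfV lef_pV2 ?posrE ?mulr_gt0 ?exprn_gt0 ?normr_gt0 ?sqr_sub_neq0 //.
apply: le_trans (lerB_normD _ _).
rewrite normrN !normrX normr_nat mulrBl mul1r lerD2l lerN2.
by rewrite ler_peMr ?exprn_ge0 // exprn_ege1 // ler1n.
Qed.

(** The invariant is a bound on the partial sums rather than on the
    coefficients: it also covers the empty list, whose coefficients are
    concentrated at 0, and it is all that an entry 1 needs.  A leading entry
    c >= 3 gives one more power of k in the denominator. *)
Lemma coefabs_bound L : well_formed L ->
  exists2 M, 0 <= M & bounded_by M (fun k => \sum_(l < k.+1) coefabs L l) /\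
    (if L is p :: _ then
       forall k, coefabs L k <= M * growth k / k%:R ^+ (if p.2 == 1%N then 1 else 2)
     else True).
Proof.
elim: L => [|p L IH] wf.
  exists 1 => //; split => // k; rewrite mul1r big_ord_recl big1 // addr0 ler01.
  exact: growth_ge1.
have [z1 adm wfL _] := well_formed_cons wf.
have {IH wfL}[M M0 [hM _]] := IH wfL.
set C := (1 - `|p.1| ^+ 2)^-1.
have C0 : 0 <= C by rewrite invr_ge0 subr_ge0 expr_le1 // ltW.
have one k l : (l <= k)%N -> coefabs L l <= M * growth k.
  move=> lk; have /andP[_] := hM k; apply: le_trans.
  by rewrite (bigD1 (Ordinal (lk : (l < k.+1)%N))) //= lerDl sumr_ge0 // =>
    i _; apply: coefabs_ge0.
suff [M' M'0 h] : exists2 M', 0 <= M' &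
    forall k, coefabs (p :: L) k <= M' * growth k / k%:R ^+ (if p.2 == 1%N then 1
      else 2).
  exists (3 * M'); first by rewrite mulr_ge0.
  split=> [k|k]; last first.
    apply: le_trans (h k) _; rewrite -!mulrA ler_peMl ?ler1n //.
    by rewrite !mulr_ge0 ?growth_ge0 // invr_ge0 exprn_ge0.
  apply/andP; split; first by apply: sumr_ge0 => l _; apply: coefabs_ge0.
  rewrite -mulrA mulrCA; apply: le_trans (ler_wpM2l M'0 (growth_sum k)).
  rewrite mulr_sumr; apply: ler_sum => l _; apply: le_trans (h l) _.
  rewrite -mulrA; apply: ler_wpM2l => //; apply: ler_wpM2l; first exact: growth_ge0.
  case: ifP => _ //; case: (nat_of_ord l) => [|m]; first by rewrite expr0n !invr0.
  by rewrite lef_pV2 ?posrE ?exprn_gt0 ?ltr0Sn // expr2 ler_peMr // ler1n.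
case/orP: (adm) => [/eqP p1|p2].
  exists (C * (2 * M)); first by rewrite !mulr_ge0.
  case=> [|k]; first by rewrite coefabs0 // p1 invr0 mulr0.
  rewrite p1 /= expr1.
  have -> : coefabs (p :: L) k.+1 =
     k.+1%:R * `|(k.+1%:R ^+ 2 - p.1 ^+ 2)^-1| * \sum_(l < k.+2) 2 ^+ Delta k.+1
       l * coefabs L l.
    rewrite mulr_sumr; apply: eq_bigr => l _; rewrite step_kernel_1 // !normrM
      normr_nat.
    by rewrite normrX normr_nat mulrA.
  have S0 : 0 <= \sum_(l < k.+2) 2 ^+ Delta k.+1 l * coefabs L l.
    by apply: sumr_ge0 => l _; rewrite mulr_ge0 ?exprn_ge0 ?coefabs_ge0.
  have S1 : \sum_(l < k.+2) 2 ^+ Delta k.+1 l * coefabs L l <= 2 * (M * growth k.+1).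
    have /andP[_ hk] := hM k.+1; apply: le_trans (ler_wpM2l (ler0n _ _) hk).
    rewrite mulr_sumr; apply: ler_sum => l _; rewrite ler_wpM2r ?coefabs_ge0 //.
    by rewrite /Delta; case: ifP => _; rewrite ?expr1 ?expr0 ?ler1n.
  have k0 : k.+1%:R != 0 :> K by rewrite pnatr_eq0.
  apply: le_trans (ler_pM _ S0 (ler_wpM2l (ler0n _ _) (denom_le z1 (ltn0Sn k))) S1) _.
    by rewrite mulr_ge0.
  rewrite le_eqVlt; apply/orP; left; apply/eqP; rewrite -/C.
  by field.
exists (C * (6 ^+ (p.2 - 2) * M)); first by rewrite !mulr_ge0 // exprn_ge0.
case=> [|k]; first by rewrite coefabs0 // gtn_eqF ?expr0n ?invr0 ?mulr0 // ltnW.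
have -> : (p.2 == 1)%N = false by rewrite gtn_eqF // ltnW.
have -> : coefabs (p :: L) k.+1 = `|(k.+1%:R ^+ 2 - p.1 ^+ 2)^-1| *
    iter (p.2 - 2) (kernel_apply (@sharp_kernel K)) (coefabs L) k.+1.
  have -> : (p.2 - 2 = (p.2 - 3).+1)%N by lia.
  rewrite -sharp_sum_iter mulr_sumr.
  transitivity (\sum_(l < k.+2) `|step_kernel p k.+1 l| * coefabs L l); first by [].
  apply: eq_bigr => l _.
  rewrite step_kernel_gt2 // !normrM !normrX !normrN1 !expr1n !mul1r (normfV
    (nat_of_ord l)%:R) normr_nat.
  by rewrite (ger0_norm (sharp_sum_ge0 _ _ _ _)); ring.
have hb : bounded_by M (coefabs L).
  by move=> l; rewrite coefabs_ge0 one.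
have /andP[i0 iM] := iter_sharp_kernel_bound (p.2 - 2) M0 hb k.+1.
apply: le_trans (ler_pM (normr_ge0 _) i0 (denom_le z1 (ltn0Sn k)) iM) _.
rewrite le_eqVlt; apply/orP; left; apply/eqP; rewrite -/C; ring.
Qed.

Lemma coefabs_sum p L : well_formed (p :: L) -> (2 < p.2)%N ->
  exists M, forall n, \sum_(k < n.+1) coefabs (p :: L) k <= M.
Proof.
move=> wf p2; have [M M0 [_ h]] := coefabs_bound wf.
exists (M * 6) => n; apply: le_trans (ler_wpM2l M0 (growth_sum2 n)).
rewrite mulr_sumr; apply: ler_sum => k _; apply: le_trans (h k) _.
by rewrite gtn_eqF ?mulrA // ltnW.
Qed.

End Bounds.

(** * Generating functions of truncated values *)

Section GenTerm.
Variable K : numFieldType.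
Implicit Types (L : seq (K * nat)) (a : seq nat).

Definition word L a : seq nat :=
  flatten [seq rcons (nseq p.2 2%N) p.1.2 | p <- zip L a].

Definition monomial L a : K := \prod_(p <- zip L a) p.1.1 ^+ (2 * p.2).

Definition star_term L n a : K :=
  if size a == size L then star K (word L a) n * monomial L a else 0.

(** Together with prepending 0, this partitions the nonempty exponent vectors
    according to whether the first block of twos is empty; the empty vector is
    fixed to keep the shift total, and carries no term. *)
Definition shift a : seq nat := if a is x :: s then x.+1 :: s else [::].
Definition unshift a : option (seq nat) :=
  if a is x :: s then (if x is y.+1 then Some (y :: s) else None) else Some [::].

Lemma unshift_pcan : pcancel shift unshift.
Proof. by case. Qed.

Lemma unshift_ocan : ocancel unshift shift.
Proof. by case=> // -[]. Qed.

Lemma star_term_nil n a : star_term [::] n a = (a == [::])%:R.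
Proof. by case: a => [|x a] //; rewrite /star_term /= /monomial big_nil mulr1. Qed.

Lemma star_term0 p L a : (0 < p.2)%N -> star_term (p :: L) 0 a = 0.
Proof.
move=> p0; rewrite /star_term; case: eqP => // sa.
case: a sa => // -[|x] a _; first by rewrite /word /= star0 // mul0r.
by rewrite /word /= star0 // mul0r.
Qed.

(** The chains counted at n+1 but not at n have largest index n+1.  Removing
    that index removes either the first entry p.2, when the first block of twos
    is empty, or one of the twos of that block. *)
Lemma star_termS p L n a : star_term (p :: L) n.+1 a =
  star_term (p :: L) n a +
  ((n.+1%:R ^+ p.2)^-1 * oapp (star_term L n.+1) 0 (uncons 0 a) +
   p.1 ^+ 2 / n.+1%:R ^+ 2 * oapp (star_term (p :: L) n.+1) 0 (unshift a)).
Proof.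
rewrite /star_term; case: a => [|[|x] a] /=; first by rewrite !mulr0 !addr0.
  rewrite eqSS mulr0 addr0; case: eqP => _; last by rewrite mulr0 addr0.
  by rewrite /word /= starS /monomial !big_cons expr0 mul1r; ring.
rewrite eqSS mulr0 add0r; case: eqP => _; last by rewrite mulr0 addr0.
rewrite /word /= starS /monomial !big_cons /= mulnS exprD; ring.
Qed.

Definition absL L : seq (K * nat) := [seq (`|p.1|, p.2) | p <- L].

Lemma well_formed_absL L : well_formed L -> well_formed (absL L).
Proof.
rewrite /well_formed /absL all_map -map_comp => /andP[h ->]; rewrite andbT.
by apply: sub_all h => p /=; rewrite normr_id.
Qed.

Lemma word_absL L a : word (absL L) a = word L a.
Proof.
rewrite /word; elim: L a => [|p L IH] [|x a] //=.
by rewrite IH.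
Qed.

Lemma monomial_absL L a : monomial (absL L) a = `|monomial L a|.
Proof.
rewrite /monomial; elim: L a => [|p L IH] [|x a]; rewrite /= ?big_nil ?normr1 //.
by rewrite !big_cons IH normrM normrX.
Qed.

Lemma norm_star_term L n a : `|star_term L n a| = star_term (absL L) n a.
Proof.
rewrite /star_term size_map; case: ifP => _; last by rewrite normr0.
by rewrite normrM word_absL monomial_absL (ger0_norm (star_ge0 _ _ _)).
Qed.

Lemma star_term_absL_ge0 L n a : 0 <= star_term (absL L) n a.
Proof. by rewrite -norm_star_term. Qed.

(** This is what makes the geometric series over the first exponent converge. *)
Lemma resolvent_lt1 (z : K) n : `|z| < 1 -> `|z ^+ 2 / n.+1%:R ^+ 2| < 1.
Proof.
move=> z1; rewrite normrM normfV !normrX normr_nat ltr_pdivrMr ?exprn_gt0 ?ltr0Sn //.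
rewrite mul1r; apply: (@lt_le_trans _ _ 1); first by rewrite expr_lt1.
by rewrite exprn_ege1 // ler1n.
Qed.

Lemma admissible_gt0 c : admissible c -> (0 < c)%N.
Proof. by rewrite /admissible; case: c. Qed.

Lemma genfun_absL_ge0 L n : well_formed L -> 0 <= genfun (absL L) n.
Proof.
elim: L n => [|p L IH] n wf; first exact: ler01.
have [z1 _ wfL _] := well_formed_cons wf.
elim: n => [|n IHn] //=; rewrite divr_ge0 //.
  by rewrite addr_ge0 // divr_ge0 ?exprn_ge0 // IH.
rewrite subr_ge0 ltW //; have := resolvent_lt1 n z1.
by rewrite normrM normfV !normrX normr_nat.
Qed.

(** At nonnegative arguments the recursion of [star_termS] bounds the finite
    sums: the sum over B is at most g(n) + b(n+1) + q g(n+1) = g(n+1), where the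
    last term bounds the shifted set, whose largest first exponent is smaller. *)
Lemma star_term_sum_le L n (B : seq (seq nat)) : well_formed L -> uniq B ->
  \sum_(a <- B) star_term (absL L) n a <= genfun (absL L) n.
Proof.
elim: L n B => [|p L IH] n B wf uB.
  under eq_bigr => a _ do rewrite star_term_nil.
  have [nB|nB] := boolP ([::] \in B); last first.
    rewrite big1_seq ?ler01 // => a /andP[_ aB].
    by case: (a =P [::]) => // a0; rewrite -a0 aB in nB.
  rewrite (bigD1_seq [::]) //= big1 ?addr0 // => a /negbTE ->.
  by [].
have [z1 adm wfL _] := well_formed_cons wf.
have q0 := resolvent_lt1 _ z1.
elim: n B uB => [|n IHn] B uB.
  by rewrite big1 // => a _; apply: star_term0; apply: admissible_gt0.
set g := genfun _ _.
set q := `|p.1| ^+ 2 / n.+1%:R ^+ 2.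
have q1 : q < 1 by have := q0 n; rewrite normrM normfV !normrX normr_nat.
have gE : g = genfun (absL (p :: L)) n + ((n.+1%:R ^+ p.2)^-1 * genfun (absL L)
  n.+1 + q * g).
  have d0 : 1 - q != 0 by rewrite subr_eq0 gt_eqF.
  rewrite addrA; apply/eqP; rewrite -subr_eq; apply/eqP.
  rewrite -[X in X - _]mul1r -mulrBl mulrC /g /= divfK //.
  by rewrite [X in _ + X = _]mulrC.
have q_ge0 : 0 <= q by rewrite divr_ge0 // exprn_ge0.
(* N bounds the first exponents of B and decreases under [unshift] *)
have [N hN] : exists N, forall a, a \in B -> a != [::] -> (head 0%N a < N)%N.
  exists (\max_(a <- B) head 0%N a).+1 => a aB _.
  by rewrite ltnS; apply: leq_bigmax_seq.
elim: N B uB hN => [|N IHN] B uB hN.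
  rewrite big1_seq => [|a /andP[_ aB]]; first exact: genfun_absL_ge0.
  by have [->|/(hN a aB)] := eqVneq a [::].
under eq_bigr => a _ do rewrite star_termS.
rewrite !big_split /= -!mulr_sumr !big_pmap_oapp gE.
apply: lerD; first exact: IHn.
apply: lerD; apply: ler_wpM2l => //.
  by apply: IH => //; apply: (pmap_uniq (@uncons_ocan 0%N)).
apply: IHN; first exact: (pmap_uniq unshift_ocan).
move=> a; rewrite mem_pmap => /mapP[b bB].
by case: b bB => [|[|x] b] bB //= [->] // _; have := hN _ bB isT.
Qed.

End GenTerm.

(** Summability comes from [star_term_sum_le]; the value is then forced, since
    the sum satisfies the same linear equation as the resolvent. *)
Lemma star_term_usum (R : realType) (L : seq (R[i] * nat)) n : well_formed L ->
  usum (star_term L n) (genfun L n).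
Proof.
elim: L n => [|p L IH] n wf.
  apply: usum_eq (usum_pathweight [::] (fun=> 1) 0) => a.
  by rewrite star_term_nil; case: a.
have [z1 adm wfL _] := well_formed_cons wf.
elim: n => [|n IHn].
  apply: usum_eq (@usum0 _ _) => a.
  by rewrite star_term0 // admissible_gt0.
have [s hs] : exists s, usum (star_term (p :: L) n.+1) s.
  apply: (@usum_exists _ _ _ (genfun (absL (p :: L)) n.+1)) => B uB.
  under eq_bigr => a _ do rewrite norm_star_term.
  exact: star_term_sum_le.
have hs' := usumD IHn (usumD
   (usumZ (n.+1%:R ^+ p.2)^-1 (usum_pinv (@uncons_pcan 0) (@uncons_ocan 0) (IH
     n.+1 wfL)))
   (usumZ (p.1 ^+ 2 / n.+1%:R ^+ 2) (usum_pinv unshift_pcan unshift_ocan hs))).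
have sE := usum_unique hs (usum_eq (fun a => esym (star_termS p L n a)) hs').
suff -> : genfun (p :: L) n.+1 = s by [].
have d0 : 1 - p.1 ^+ 2 / n.+1%:R ^+ 2 != 0.
  rewrite subr_eq0; apply/eqP => /(congr1 Num.norm).
  by rewrite normr1 => e; have := resolvent_lt1 n z1; rewrite -e ltxx.
apply: (mulIf d0); rewrite /= divfK // mulrBr mulr1 {1}sE [s * _]mulrC addrA addrK.
by rewrite mulrC.
Qed.

(** * The zeta-star side in the limit *)

Lemma genfun_bounded (K : numFieldType) (p : K * nat) L :
  well_formed (p :: L) -> (2 < p.2)%N ->
  exists M, forall n, `|genfun (p :: L) n| <= M.
Proof.
move=> wf p2; have [M hM] := coefabs_sum wf p2; exists M => n.
rewrite genfunE //; apply: le_trans (hM n); apply: le_trans (ler_norm_sum _ _ _) _.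
apply: ler_sum => k _; rewrite normrM (ger0_norm (binom_ratio_ge0 _ _ _)).
apply: le_trans (coef_le _ _); apply: ler_piMl; first exact: normr_ge0.
exact: binom_ratio_le1.
Qed.

Section LeftSide.
Variable R : realType.
Implicit Types (L : seq (R[i] * nat)) (a : seq nat).

Lemma all_word L a : well_formed L -> all (leq 1) (word L a).
Proof.
case/andP => h _; elim: L a h => [|p L IH] [|x a] //= /andP[/andP[_ adm] h].
by rewrite /word /= all_cat all_rcons all_nseq orbT andbT admissible_gt0 // IH.
Qed.

Lemma star_mono s n m : (n <= m)%N -> star R s n <= star R s m.
Proof.
move=> /subnK <-; elim: (m - n)%N => // k IH; apply: le_trans IH _.
by case: s => [|p s] //; rewrite addSn starS lerDl mulr_ge0 ?star_ge0.
Qed.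

(** A single zeta-star value is read off the bounded generating function at
    z_j = 1/2, where its monomial is positive even if some original z_j is 0. *)
Lemma star_word_bounded p L a : well_formed (p :: L) -> (2 < p.2)%N ->
  size a = size (p :: L) -> exists M, forall n, star R (word (p :: L) a) n <= M.
Proof.
move=> wf p2 sa.
pose H : seq (R[i] * nat) := [seq (2^-1, q.2) | q <- p :: L].
have half : `|2^-1 : R[i]| = 2^-1 by rewrite ger0_norm.
have wfH : well_formed H.
  rewrite /well_formed /H all_map -map_comp.
  case/andP: wf => h ->; rewrite andbT; apply: sub_all h => q /= /andP[_ ->].
  by rewrite half andbT invf_lt1 ?ltr1n.
have HE : absL H = H.
  by rewrite /absL -map_comp; apply: eq_map => q /=; rewrite half.
have wE : word H a = word (p :: L) a.
  rewrite /word /H; elim: (p :: L) (a) => [|q L' IH] [|x a'] //=.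
  by rewrite IH.
have m0 : 0 < monomial H a.
  rewrite /monomial /H; elim: (p :: L) (a) =>
    [|q L' IH] [|x a']; rewrite /= ?big_nil //.
  by rewrite big_cons; apply: mulr_gt0 (IH _); rewrite exprn_gt0 // invr_gt0 ltr0n.
have [M hM] := genfun_bounded wfH p2.
exists (complex.Re (M / monomial H a)) => n.
have : star R[i] (word (p :: L) a) n <= M / monomial H a.
  rewrite ler_pdivlMr //.
  have -> : star R[i] (word (p :: L) a) n * monomial H a = star_term (absL H) n a.
    by rewrite HE /star_term size_map sa eqxx wE.
  apply: le_trans (hM n); rewrite ger0_norm;
    last by rewrite -[_ :: _]/H -HE genfun_absL_ge0.
  have := star_term_sum_le n wfH (isT : uniq [:: a]).
  by rewrite big_seq1 {2}HE.
by rewrite star_realC lecE => /andP[_].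
Qed.

Definition zeta_term L a : R[i] :=
  if size a == size L then (zeta_star R (word L a))%:C%C * monomial L a else 0.

Lemma norm_zeta_term p L a : well_formed (p :: L) -> (2 < p.2)%N ->
  `|zeta_term (p :: L) a| = zeta_term (absL (p :: L)) a.
Proof.
move=> wf p2; rewrite /zeta_term [size (absL _)]size_map; case: eqP => sa;
  last by rewrite normr0.
rewrite normrM word_absL monomial_absL; congr (_ * _).
have [M hM] := star_word_bounded wf p2 sa.
have [h _] := zeta_star_bound (all_word a wf) hM.
apply: ger0_norm; rewrite ler0c; apply: le_trans (h 0%N); exact: star_ge0.
Qed.

(** The distance to the limit is the same difference at the absolute values
    of the arguments, because S_n increases to the zeta-star value. *)
Lemma zeta_term_dist p L n a : well_formed (p :: L) -> (2 < p.2)%N ->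
  `|star_term (p :: L) n a - zeta_term (p :: L) a| =
    zeta_term (absL (p :: L)) a - star_term (absL (p :: L)) n a /\
  tends (fun n => star_term (p :: L) n a - zeta_term (p :: L) a) 0.
Proof.
move=> wf p2; rewrite /zeta_term /star_term ![size (absL _)]size_map.
case: eqP => sa; last first.
  split; first by rewrite !subrr normr0.
  by move=> e e0; exists 0%N => m _; rewrite !subrr normr0.
have [M hM] := star_word_bounded wf p2 sa.
have [h _] := zeta_star_bound (all_word a wf) hM.
set Z := zeta_star _ _ in h *.
have hZ m : `|(Z - star R (word (p :: L) a) m)%:C%C| =
  (Z - star R (word (p :: L) a) m)%:C%C.
  by apply: ger0_norm; rewrite ler0c subr_ge0 h.
split.
  rewrite -mulrBl normrM distrC !word_absL monomial_absL -mulrBl star_realC -rmorphB.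
  by rewrite hZ.
have t : tends (fun n => star R[i] (word (p :: L) a) n - Z%:C%C) 0.
  move=> [x y]; rewrite ltcE /= => /andP[/eqP -> x0].
  have [N hN] : exists N, Z - x < star R (word (p :: L) a) N.
    apply: contrapT => /forallNP hn.
    have [|_] := @zeta_star_bound _ _ (all_word a wf) (Z - x).
      by move=> m; rewrite leNgt; apply/negP/hn.
    by rewrite -/Z lerBrDl gerDr leNgt x0.
  exists N => m Nm; rewrite subr0 distrC star_realC -rmorphB hZ.
  rewrite ltcR ltrBlDr -ltrBlDl; apply: lt_le_trans hN _; exact: star_mono.
move=> e e0; have [N hN] := tends0Z (monomial (p :: L) a) t e0.
by exists N => m /hN; rewrite mulrBl.
Qed.

(** Summability passes from the truncated terms to their limits, since every
    finite sum at |z_j| stays below the bound on G_n at |z_j|. *)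
Lemma zeta_term_usum p L : well_formed (p :: L) -> (2 < p.2)%N ->
  exists2 s, usum (zeta_term (p :: L)) s & tends (fun n => genfun (p :: L) n - s) 0.
Proof.
move=> wf p2.
have wfA := well_formed_absL wf.
have AA : absL (absL (p :: L)) = absL (p :: L).
  by rewrite /absL -map_comp; apply: eq_map => q /=; rewrite normr_id.
have [M hM] := genfun_bounded wfA p2.
have bound B : uniq B -> \sum_(a <- B) zeta_term (absL (p :: L)) a <= M.
  move=> uB.
  have hg n : \sum_(a <- B) star_term (absL (p :: L)) n a <= M.
    apply: le_trans (star_term_sum_le n wf uB) _; apply: le_trans (hM n).
    by apply: real_ler_norm; apply: ger0_real; apply: (genfun_absL_ge0 n wf).
  have Mr : M \is Num.real.
    by apply: ger0_real; apply: le_trans (hM 0%N).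
  have zr : \sum_(a <- B) zeta_term (absL (p :: L)) a \is Num.real.
    by apply: sum_real => a _; rewrite -norm_zeta_term // normr_real.
  rewrite real_leNgt //; apply/negP => lt.
  have t : tends (fun n => \sum_(a <- B) (star_term (absL (p :: L)) n a -
    zeta_term (absL (p :: L)) a)) 0.
    apply: tends0_sum => a _.
    by have [_] := zeta_term_dist 0 a wfA p2.
  have e0 : 0 < \sum_(a <- B) zeta_term (absL (p :: L)) a - M by rewrite subr_gt0.
  have [N hN] := t _ e0; have := hN N (leqnn _).
  rewrite subr0 sumrB distrC => /(le_lt_trans (real_ler_norm _)).
  rewrite ltrD2l ltrN2 => h.
  have /h : \sum_(i <- B) zeta_term (absL (p :: L)) i - \sum_(i <- B) star_term
    (absL (p :: L)) N i \is Num.real.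
    by rewrite rpredB // ger0_real // sumr_ge0 // => a _; apply: star_term_absL_ge0.
  by move=> /lt_le_trans /(_ (hg N)); rewrite ltxx.
have [s hs] : exists s, usum (zeta_term (p :: L)) s.
  apply: (@usum_exists _ _ _ M) => B uB.
  under eq_bigr => a _ do rewrite norm_zeta_term //.
  exact: bound.
have [t ht] : exists t, usum (zeta_term (absL (p :: L))) t.
  apply: (@usum_exists _ _ _ M) => B uB.
  under eq_bigr => a _ do rewrite norm_zeta_term // AA.
  exact: bound.
exists s => //.
apply: (tannery ht) (fun n => usumB (star_term_usum n wf) hs).
  move=> n a; have [-> _] := zeta_term_dist n a wf p2.
  by rewrite gerBl star_term_absL_ge0.
by move=> a; have [_] := zeta_term_dist 0 a wf p2.
Qed.

End LeftSide.

(** * The sharp side in the limit, and the theorem *)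

Local Open Scope classical_set_scope.
Local Open Scope ring_scope.
Local Open Scope complex_scope.

Lemma pathweight_norm (K : numFieldType) (I : Type) (ker : I -> nat -> nat -> K)
    (r : seq I) (e e' : nat -> K) k ls : (forall l, `|e l| <= e' l) ->
  `|pathweight (map ker r) e k ls| <=
  pathweight [seq (fun k l => `|ker i k l|) | i <- r] e' k ls.
Proof.
move=> ee'; elim: r k ls => [|i r IH] k [|l ls] //=; rewrite ?normr0 //.
by case: ifP => _; rewrite ?normr0 // normrM ler_wpM2l.
Qed.

Section RightSide.
Variable R : realType.
Variables (L : seq (R[i] * nat)) (q : R[i] * nat).
Hypotheses (wf : well_formed (rcons L q)) (big : (2 < (head q L).2)%N).

(** The term of the chain k_0 >= ... >= k_d; the coefficient of the last block
    is the end weight at k_d. *)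
Definition chain_term (ks : seq nat) : R[i] :=
  if ks is k :: ls then pathweight (map (@step_kernel _) L) (coef [:: q]) k ls else 0.

Let damped_term n (ks : seq nat) : R[i] :=
  pathweight (binom_ratio R[i] :: map (@step_kernel _) L) (coef [:: q]) n ks.

Lemma coef_rcons k : pathsum (map (@step_kernel _) L) (coef [:: q]) k =
  coef (rcons L q) k.
Proof. by rewrite /coef map_rcons /pathsum foldr_rcons. Qed.

Lemma damped_term_usum n : usum (damped_term n) (genfun (rcons L q) n).
Proof.
rewrite genfunE //; under eq_bigr => k _ do rewrite -coef_rcons.
exact: (usum_pathweight (binom_ratio R[i] :: map (@step_kernel _) L) (coef [:: q]) n).
Qed.

Lemma damped_termE n k ls :
  damped_term n (k :: ls) = if (k <= n)%N then binom_ratio R[i] n k * chain_term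
    (k :: ls) else 0.
Proof. by []. Qed.

(** Finitely many chains lie below a common n, where the sum of absolute values
    is at most the n-th partial sum of [coefabs]. *)
Lemma chain_term_bounded : exists M : R[i], forall B, uniq B ->
  \sum_(ks <- B) `|chain_term ks| <= M.
Proof.
have [M hM] : exists M, forall n, \sum_(k < n.+1) coefabs (rcons L q) k <= M.
  case: (L) wf big => [|p L'] w b; exact: (coefabs_sum w b).
exists M => B uB.
pose n := \max_(ks <- B) head 0%N ks.
pose ka (p : R[i] * nat) k l := `|step_kernel p k l|.
pose W := pathweight ((fun _ _ => 1) :: map ka L) (coefabs [:: q]) n.
have hW : usum W (\sum_(k < n.+1) coefabs (rcons L q) k).
  have -> : \sum_(k < n.+1) coefabs (rcons L q) k =
     pathsum ((fun _ _ => 1) :: map ka L) (coefabs [:: q]) n.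
    apply: eq_bigr => k _; rewrite mul1r.
    by rewrite /coefabs map_rcons {1}/pathsum foldr_rcons.
  exact: usum_pathweight.
have W0 ks : 0 <= W ks.
  rewrite /W; case: ks => [|k ls] //=; case: ifP => // _; rewrite mul1r.
  have h l : `|0 : R[i]| <= coefabs [:: q] l by rewrite normr0 coefabs_ge0.
  exact: le_trans (normr_ge0 _) (pathweight_norm (@step_kernel _) L k ls h).
apply: le_trans (hM n); apply: le_trans (usum_ge W0 _ hW uB); last first.
  by apply: ger0_real; apply: sumr_ge0 => k _; apply: coefabs_ge0.
rewrite big_seq [leRHS]big_seq; apply: ler_sum => ks kB.
have : (head 0%N ks <= n)%N by rewrite /n; apply: leq_bigmax_seq.
rewrite /W; case: ks {kB} => [|k ls] /=; first by rewrite normr0.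
move=> ->; rewrite mul1r; apply: pathweight_norm => l; exact: coef_le.
Qed.

(** The truncated chain terms w_n(k_0) * (chain term) sum to G_n. *)
Lemma chain_term_usum :
  exists2 s, usum chain_term s & tends (fun n => genfun (rcons L q) n - s) 0.
Proof.
have [M hM] := chain_term_bounded.
have [s hs] := usum_exists hM.
have [t ht] : exists t, usum (fun ks => `|chain_term ks|) t.
  apply: (@usum_exists _ _ _ M) => B /hM; under eq_bigr do rewrite -normr_id.
  by [].
exists s => //; apply: (tannery ht) (fun n => usumB (damped_term_usum n) hs).
  move=> n [|k ls]; first by rewrite /damped_term /= subrr normr0.
  rewrite damped_termE; case: ifP => _; last by rewrite sub0r normrN.
  rewrite -[X in _ - X]mul1r -mulrBl normrM ler_piMl //.
  by rewrite distrC ger0_norm ?subr_ge0 ?binom_ratio_le1 // gerBl binom_ratio_ge0.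
move=> [|k ls]; first by move=> e e_gt0; exists 0%N =>
  n _; rewrite /damped_term /= !subrr normr0.
move=> e e_gt0; have [N hN] := tends0Z (chain_term (k :: ls)) (@tends_binom_ratio
  R k) e_gt0.
exists (maxn N k) => n; rewrite geq_max => /andP[Nn kn].
by rewrite damped_termE kn -[X in _ * _ - X]mul1r -mulrBl; apply: hN.
Qed.

End RightSide.

Section Matching.
Variables (R : realType) (d : nat) (c : d.-tuple nat) (z : 'I_d.+1 -> R[i]).

(** The list of pairs (z_i, c_(i+1)), 0 <= i <= d, with c_(d+1) = 1; [front] and
    [final] split off its last pair. *)
Let blocks : seq (R[i] * nat) := [seq (z i, entry c i.+1) | i <- enum 'I_d.+1].

Lemma generating_termE (a : d.+1.-tuple nat) :
  generating_term c z a = zeta_term blocks a.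
Proof.
have az : zip blocks a = [seq ((z i, entry c i.+1), tnth a i) | i <- enum 'I_d.+1].
  by rewrite -{1}(map_tnth_enum a) zip_map.
rewrite /zeta_term size_tuple size_map size_enum_ord eqxx.
rewrite /word /monomial az -map_comp big_map big_enum /=.
by [].
Qed.

Let front : seq (R[i] * nat) :=
  [seq (z (widen_ord (leqnSn d) i), entry c i.+1) | i <- enum 'I_d].
Let final : R[i] * nat := (z ord_max, entry c d.+1).

Lemma blocks_rcons : blocks = rcons front final.
Proof. by rewrite /blocks enum_ordSr map_rcons -map_comp. Qed.

Lemma entry_last : entry c d.+1 = 1%N.
Proof. by rewrite /entry /= nth_default // size_tuple. Qed.

(** The signs agree because the exponents differ by 2k. *)
Lemma factor_split e e' k : (0 < k)%N ->
  (-1) ^+ (k * (delta e + delta e')) * k%:R ^ ((delta e + delta e')%:Z - 1) =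
  rfactor R[i] e k * lfactor R[i] e' k.
Proof.
move=> k0; have kn : k%:R != 0 :> R[i] by rewrite pnatr_eq0 -lt0n.
rewrite /rfactor /lfactor [RHS]mulrACA -exprD.
have -> : (k * (1 + delta e) + k * (1 + delta e') = 2 * k + k * (delta e + delta e'))%N.
  by lia.
rewrite [in RHS]exprD (exprM _ 2 k) sqrrN !expr1n.
rewrite mul1r; congr (_ * _).
by rewrite PoszD addrAC expfzDr.
Qed.

(** The factor i of the sharp term involves the entries on both sides of k_i,
    a kernel the two indices around one entry.  Regrouping by entries leaves the
    sharp sum 2 of the first factor, which matches the 2^Delta(k_d,0) = 2 of the
    final block. *)
Lemma sharp_termE (k : d.+1.-tuple nat) : decreasing_chains d.+1 k ->
  sharp_term c z k = chain_term front final k.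
Proof.
move=> /andP[sk pk].
have kE : tval k = nth 0%N k 0 :: behead k by case: k sk pk => [[|x s]].
pose kk i := nth 0%N k i.
have kk0 i : (i < d.+1)%N -> (0 < kk i)%N.
  by move=> id; apply: (allP pk); rewrite mem_nth // size_tuple.
have kkS i : nth 0%N (behead k) i = kk i.+1 by rewrite nth_behead.
have sz : size (behead k) = d by rewrite size_behead size_tuple.
have szf : size [seq step_kernel i | i <- front] = d.
  by rewrite /front 2!size_map size_enum_ord.
rewrite /chain_term kE pathweightE szf sz eqxx /=.
have -> : path geq (nth 0%N k 0) (behead k) by move: sk; rewrite kE.
have -> : last (nth 0%N k 0) (behead k) = kk d.
  by rewrite (last_nth 0%N) sz -kE.
have -> : coef [:: final] (kk d) =
    lfactor R[i] 1%N (kk d) / ((kk d)%:R ^+ 2 - z ord_max ^+ 2) * 2.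
  rewrite /coef /= /kernel_apply big_ord_recl big1 ?addr0 ?mulr1 => [|i _];
    last by rewrite mulr0.
  rewrite step_kernel_1; last exact: entry_last.
  rewrite /lfactor delta1 expr1 mulnC exprM sqrrN !expr1n mul1r.
  by rewrite /Delta gtn_eqF ?kk0.
pose A i : R[i] := rfactor _ (entry c i) (kk i) *
  sharp_sum R[i] (prev_index k i) (kk i) (nseq (entry c i - 3) 1%N).
pose B (i : 'I_d.+1) : R[i] := lfactor _ (entry c i.+1) (kk i) / ((kk i)%:R ^+ 2
  - z i ^+ 2).
rewrite /sharp_term (eq_bigr (fun i : 'I_d.+1 => A i * B i)); last first.
  move=> i _; rewrite (tnth_nth 0%N) -/(kk i) factor_split ?kk0 // /A /B; ring.
rewrite big_split big_ord_recl [X in _ * X = _]big_ord_recr /=.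
have A0 : A 0%N = 2.
  rewrite /A /rfactor delta1 subrr expr0z mulr1 mulnC exprM sqrrN !expr1n mul1r.
  by rewrite /sharp_sum /= /Delta ltn_eqF ?kk0.
have last_factor : B ord_max =
    lfactor R[i] 1%N (kk d) / ((kk d)%:R ^+ 2 - z ord_max ^+ 2).
  by rewrite /B /= entry_last.
have -> : \prod_(j < d) nth (fun _ _ => 0) [seq step_kernel i | i <- front] j
     (nth 0%N (nth 0%N k 0 :: behead k) j) (nth 0%N (behead k) j) =
   \prod_(i < d) B (widen_ord (leqnSn d) i) * \prod_(i < d) A i.+1.
  rewrite -big_split; apply: eq_bigr => j _.
  rewrite (nth_map final); last by rewrite size_map size_enum_ord.
  rewrite (nth_map j); last by rewrite size_enum_ord.
  rewrite nth_ord_enum kkS -kE -/(kk j) /step_kernel /B /A /=.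
  by [].
rewrite A0 last_factor.
ring.
Qed.
(** A chain reaching 0 ends in 0, and the final coefficient vanishes there. *)
Lemma chain_term_eq0 (y : seq nat) :
  (forall k : d.+1.-tuple nat, decreasing_chains d.+1 k -> y <> val k) ->
  chain_term front final y = 0.
Proof.
case: y => [|x ls] // hy; rewrite /chain_term pathweightE.
have szf : size [seq step_kernel i | i <- front] = d.
  by rewrite /front 2!size_map size_enum_ord.
rewrite szf; case: (size ls =P d) => //= sl; case: ifP => // pl.
have -> : last x ls = 0%N.
  (* otherwise all entries are positive and the sequence is a chain *)
  apply: contrapT => /eqP; rewrite -lt0n => l0.
  have st : size (x :: ls) == d.+1 by rewrite /= sl.
  apply: (hy (Tuple st)) => //; apply/andP; split => //.
  apply/allP => j jx; apply: leq_trans l0 _.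
  have {}jx : j \in x :: ls by exact: jx.
  elim: ls x j pl jx {hy sl st} => [|l ls IH] x j /=; first by rewrite inE => _ /eqP ->.
  move=> /andP[lx pl]; rewrite inE => /orP[/eqP ->|jl]; last exact: IH pl jl.
  by apply: leq_trans lx; apply: IH => //; rewrite mem_head.
by rewrite coef0 ?mulr0 // /= entry_last.
Qed.

Lemma blocks_well_formed :
  (forall i : nat, (1 <= i <= d)%N -> (1 <= entry c i)%N /\ entry c i <> 2%N) ->
  (forall j, `|z j| < 1) -> well_formed blocks.
Proof.
move=> hc hz; apply/andP; split; last first.
  by rewrite blocks_rcons map_rcons last_rcons /= entry_last.
rewrite /blocks all_map; apply/allP => i _ /=; rewrite hz /=.
have [id|di] := ltnP i d; last first.
  have -> : nat_of_ord i = d by apply/eqP; rewrite eqn_leq di andbT -ltnS.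
  by rewrite entry_last.
have [] := hc i.+1 id; rewrite /admissible; case: (entry _ _) => [|[|[|e]]] //.
Qed.

Lemma blocks_head : (head final front).2 = entry c 1.
Proof.
have : head final blocks = head final front by rewrite blocks_rcons headI.
by move=> <-; rewrite /blocks enum_ordSl.
Qed.

Lemma sharp_generating_has_sum :
  well_formed blocks -> (2 < entry c 1)%N ->
  exists s, has_sum [set: d.+1.-tuple nat] (generating_term c z) s /\
    has_sum (decreasing_chains d.+1) (sharp_term c z) s.
Proof.
move=> wf c1.
have bE : blocks = (z ord0, entry c 1) :: [seq (z i, entry c i.+1) | i <- [seq
  lift ord0 j | j <- enum 'I_d]].
  by rewrite /blocks enum_ordSl.
have [s hs ls] : exists2 s, usum (zeta_term blocks) s & tends (fun n =>
  genfun blocks n - s) 0.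
  by move: wf; rewrite bE => wf'; apply: zeta_term_usum.
have [t ht lt] : exists2 s, usum (chain_term front final) s &
    tends (fun n => genfun blocks n - s) 0.
  by move: wf; rewrite blocks_rcons => wf'; apply: chain_term_usum =>
    //; rewrite blocks_head.
have st : s = t.
  apply: (@tends_unique _ (genfun blocks)).
    by move=> e e0; have [N hN] := ls e e0; exists N => n /hN; rewrite subr0.
  by move=> e e0; have [N hN] := lt e e0; exists N => n /hN; rewrite subr0.
exists s; split.
  apply: (usum_has_sum (h := val)) hs; first exact: val_inj.
    by move=> a _; exact: generating_termE.
  move=> y hy; rewrite /zeta_term; case: eqP => // sy.
  have sy' : size y == d.+1 by rewrite sy size_map size_enum_ord.
  by case: (hy (Tuple sy')).
rewrite st; apply: (usum_has_sum (h := val)) ht; first exact: val_inj.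
  exact: sharp_termE.
exact: chain_term_eq0.
Qed.

End Matching.

Theorem corollary1p4p2 (R : realType) (d : nat) (hd : (1 <= d)%N)
    (c : d.-tuple nat)
    (hc : forall i : nat, (1 <= i <= d)%N ->
       (1 <= entry c i)%N /\ entry c i <> 2%N)
    (hc1 : (3 <= entry c 1)%N)
    (z : 'I_d.+1 -> R[i]) (hz : forall j : 'I_d.+1, `|z j| < 1) :
  exists s : R[i],
    has_sum [set: d.+1.-tuple nat] (generating_term c z) s /\
    has_sum (decreasing_chains d.+1) (sharp_term c z) s.
Proof.
exact: sharp_generating_has_sum (blocks_well_formed hc hz) hc1.
Qed.
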